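(* Let $(X,T)$ be a compact dynamical system with the strong approximate product structure, and let $V\subseteq\mathcal{M}_T(X)$ be a nonempty closed connected set whose complement $U=\mathcal{M}_T(X)\setminus V$ is also nonempty. Then (1) the sets $G_V$ and $G(V)$ are $\boldsymbol{\Pi}^0_3$-complete; (2) the set ${}^{U}G$ is $\boldsymbol{\Sigma}^0_3$-complete.
   Context: A compact dynamical system $(X,T)$ is a compact metrizable space $X$ with a fixed compatible metric $\rho$ and a continuous map $T\colon X\to X$. $\mathcal{M}(X)$ is the space of Borel probability measures on $X$ with the weak$^*$ topology; $\mathcal{M}_T(X)$ is the subspace of $T$-invariant measures; ''closed'' and ''connected'' refer to this topology. For $x\in X$, $n\ge1$, $\mathcal{E}(x,n)=\frac1n\sum_{j=0}^{n-1}\delta_{T^j(x)}$. $V(x)$ is the set of limit points (limits of convergent subsequences) in $\mathcal{M}(X)$ of $(\mathcal{E}(x,n))_n$. For $V\subseteq\mathcal{M}_T(X)$: $G_V=\{x: V(x)\subseteq V\}$, $G(V)=\{x:V(x)=V\}$, ${}^{V}G=\{x:V(x)\cap V\ne\emptyset\}$. Strong approximate product structure: a specification is a finite sequence $\xi=(\langle x_j,n_j\rangle)_{j=1}^k$ with $x_j\in X$, $n_j\ge1$, $k\ge 1$. For finite $\Lambda\subseteq\{0,1,2,\dots\}$, $B_\Lambda(x,\varepsilon)=\{y:\rho(T^j x,T^j y)<\varepsilon\ \forall j\in\Lambda\}$, and $B_n=B_{\{0,\dots,n-1\}}$. A point $y$ $(\varepsilon,\delta_1,\delta_2)$-approximately-traces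 $\xi$ if $y\in B_{n_1}(x_1,\varepsilon)$ and for each $2\le j\le k$ there are $\Lambda_j\subseteq\{0,\dots,n_j-1\}$ with $|\Lambda_j|\ge(1-\delta_1)n_j$ and an integer $0\le s_{j-1}\le\delta_2 n_j$ such that $T^{\sum_{i=1}^{j-1}(s_i+n_i)}(y)\in B_{\Lambda_j}(x_j,\varepsilon)$. $(X,T)$ has the strong approximate product structure if for all $\varepsilon,\delta_1,\delta_2>0$ there is a nonnegative integer $N$ such that for every specification with all $n_j\ge N$ there is a point $y\in X$ that $(\varepsilon,\delta_1,\delta_2)$-approximately-traces it. Borel hierarchy: $\boldsymbol{\Sigma}^0_1$ = open sets, $\boldsymbol{\Pi}^0_n$ = complements of $\boldsymbol{\Sigma}^0_n$ sets, $\boldsymbol{\Sigma}^0_{n+1}$ = countable unions of $\boldsymbol{\Pi}^0_n$ sets. $A$ is $\boldsymbol{\Pi}^0_3$-complete if $A\in\boldsymbol{\Pi}^0_3\setminus\boldsymbol{\Sigma}^0_3$, and $\boldsymbol{\Sigma}^0_3$-complete if $A\in\boldsymbol{\Sigma}^0_3\setminus\boldsymbol{\Pi}^0_3$. *)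

(* Defs.v *)
From HB Require Import structures.
From mathcomp Require Import all_boot all_order all_algebra finmap.
From mathcomp Require Import all_classical all_reals all_analysis.

Set Implicit Arguments.
Unset Strict Implicit.
Unset Printing Implicit Defensive.

Import Order.TTheory GRing.Theory Num.Theory.
Import numFieldNormedType.Exports.

Local Open Scope classical_set_scope.
Local Open Scope ring_scope.

(* The point is only there because [measurableType] requires one: a space that
   carries a probability measure is nonempty anyway. *)
#[short(type="pmetricType")]
HB.structure Definition PointedMetric (K : numDomainType) :=
  {M of Metric K M & isPointed M}.

Definition borel (X : ptopologicalType) : Type :=
  g_sigma_algebraType (@open X).
HB.instance Definition _ (X : ptopologicalType) :=
  Measurable.copy (borel X) (g_sigma_algebraType (@open X)).

Section Measures.
Context {R : realType} (X : pmetricType R).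

Definition integrals (mu : probability (borel X) R) :
    {ptws continuousType X R -> R} :=
  fun f => (\int[mu]_x f x)%R.

(* The weak* topology is the coarsest one making mu |-> \int f dmu continuous
   for each continuous f : X -> R.
   A [probability] is a function on all subsets of X, with no constraint off the
   Borel sets, so a Borel measure has several representatives here. Those are
   topologically indistinguishable: closed sets, the set of invariant measures
   and the limit sets below are all unions of full classes of representatives,
   so nothing stated with them depends on the choice of representatives. *)
Definition measures : Type := initial_topology integrals.
HB.instance Definition _ := Topological.on measures.

End Measures.

Section Empirical.
Context {R : realType} (X : pmetricType R) (T : X -> X).

(* [empirical x n] averages the first n.+1 points of the orbit of x, so it is
   E(x, n + 1). *)
Definition empirical (x : X) (n : nat) : set (borel X) -> \bar R :=
  mscale (n.+1%:R^-1)%:nng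
    (msum (fun j => \d_(iter j T x : borel X)) n.+1).

HB.instance Definition _ x n := Measure.on (empirical x n).

Let empirical_setT x n : empirical x n setT = 1%E.
Proof.
rewrite /empirical /mscale /= /msum.
under eq_bigr do rewrite /= diracT.
by rewrite sumEFin sumr_const card_ord -EFinM mulVf.
Qed.

HB.instance Definition _ x n :=
  Measure_isProbability.Build _ _ _ (empirical x n) (empirical_setT x n).

End Empirical.

Section Dynamics.
Context {R : realType} (X : pmetricType R) (T : X -> X).

Definition invariant_measures : set (measures X) :=
  [set mu : probability (borel X) R |
    forall A : set (borel X), measurable A -> mu (T @^-1` A) = mu A].

Definition empirical_measure (x : X) (n : nat) : measures X :=
  (empirical T x n : probability (borel X) R).

Definition limit_measures (x : X) : set (measures X) :=
  [set mu | exists2 g : nat -> nat, increasing_seq g &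
    empirical_measure x \o g @ \oo --> mu].

Definition G_sub (V : set (measures X)) : set X :=
  [set x | limit_measures x `<=` V].

Definition G_eq (V : set (measures X)) : set X :=
  [set x | limit_measures x = V].

Definition G_meet (V : set (measures X)) : set X :=
  [set x | limit_measures x `&` V !=set0].

Definition bowen_ball (L : {fset nat}) (x : X) (e : R) : set X :=
  [set y | forall j, j \in L -> mdist (iter j T x) (iter j T y) < e].

Definition initial_segment (n : nat) : {fset nat} :=
  [fset j in iota 0 n]%fset.

(* A specification of length k.+1 is xi : 'I_k.+1 -> X * nat, indexed from 0;
   s i is the length of the gap that follows the i-th block. *)
Definition approx_traces (e d1 d2 : R) (k : nat) (xi : 'I_k.+1 -> X * nat)
    (y : X) : Prop :=
  bowen_ball (initial_segment (xi ord0).2) (xi ord0).1 e y /\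
  exists s : nat -> nat, forall j : 'I_k.+1, (0 < j)%N ->
    (s j.-1)%:R <= d2 * (xi j).2%:R /\
    exists L : {fset nat},
      [/\ (L `<=` initial_segment (xi j).2)%fset,
          (1 - d1) * (xi j).2%:R <= #|` L|%:R &
          bowen_ball L (xi j).1 e
            (iter (\sum_(i < k.+1 | (i < j)%N) (s i + (xi i).2)) T y)].

Definition strong_approx_product_structure : Prop :=
  forall e d1 d2 : R, 0 < e -> 0 < d1 -> 0 < d2 ->
  exists N : nat, forall (k : nat) (xi : 'I_k.+1 -> X * nat),
    (forall j, (1 <= (xi j).2)%N) ->
    (forall j, (N <= (xi j).2)%N) ->
    exists y : X, approx_traces e d1 d2 xi y.

End Dynamics.

Section BorelHierarchy.
Context {X : topologicalType}.

(* The hierarchy starts at level 1; level 0 is a junk value. *)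
Fixpoint Sigma0 (n : nat) : set_system X :=
  match n with
  | 0 => set0
  | 1 => open
  | (m.+1 as n').+1 => [set A | exists2 F : nat -> set X,
      (forall i, Sigma0 n' (~` F i)) & A = \bigcup_i F i]
  end.

Definition Pi0 (n : nat) : set_system X := [set A | Sigma0 n (~` A)].

Definition Sigma0_complete (n : nat) (A : set X) : Prop :=
  Sigma0 n A /\ ~ Pi0 n A.

Definition Pi0_complete (n : nat) (A : set X) : Prop :=
  Pi0 n A /\ ~ Sigma0 n A.

End BorelHierarchy.

(* Main.v *)
Require Import Defs.
From HB Require Import structures.
From mathcomp Require Import all_boot all_order all_algebra finmap.
From mathcomp Require Import all_classical all_reals all_analysis.
From mathcomp Require Import measurable_realfun ring lra zify.

Set Implicit Arguments.
Unset Strict Implicit.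
Unset Printing Implicit Defensive.

Import Order.TTheory GRing.Theory Num.Theory.
Import numFieldNormedType.Exports.

Local Open Scope classical_set_scope.
Local Open Scope ring_scope.

(* Upper bounds: by compactness of the space of measures, V(x) is contained in the
   closed set V iff, for every box B of a countable base whose closure misses V,
   the empirical measures of x eventually leave B.

   Lower bounds: the set of sequences of naturals that tend to infinity is not
   Sigma^0_3, so it suffices to map sequences a continuously to points f(a) such
   that V(f(a)) = V if a tends to infinity and V(f(a)) is not contained in V
   otherwise. Since V is connected, some sequence of measures v_j in V moves by
   smaller and smaller steps, accumulates at every point of V and returns
   infinitely often to a point mu such that the half-open segment from mu to some
   fixed invariant nu outside V misses V. The orbit of f(a) imitates v_j for a
   time that is long compared with its past, and at the j-th stage, if v_j = mu, it then
   imitates nu during the fraction 1/(a_j + 1) of the elapsed time. Nonvanishing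
   fractions leave a limit measure on the segment. To imitate an invariant measure
   no ergodic theorem is needed: a greedy choice of orbit segments makes their
   averages converge to it, and one specification made of the past orbit and these
   segments, traced with errors 2^-p at the p-th step, continues the orbit. Because
   the first block of a specification is traced without exceptions, the successive
   points converge, and f is continuous. *)

(** * Compact metric spaces *)

(** The phase lengths of the orbit depend on the sequence a, and the points reached depend on the
    earlier phases. So the threshold in [tracing_step] has to be uniform in the point reached so far
    and in the switching times: the numbers [A p] are fixed beforehand, and every timetable above
    them can be followed. That v returns to mu exactly, and not just close to it, decides the
    negative case: if a takes a value c infinitely often at such stages, the averages at the ends of
    these cycles converge to one measure, the mixture of mu and nu in which nu has weight 1/(c+2).
    Only the a_j with v_j = mu are read, so the hard set consists of the sequences tending to
    infinity along an infinite set J. Compactness of the space of measures enters as the existence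
    of limit measures. It comes from an ultrafilter limit of orbit averages, taken on all bounded
    functions, and a representation theorem. Part (2) is the complement of the statement on G_V,
    because limit measures are invariant. *)

Section CompactMetric.
Context {R : realType} {X : pmetricType R}.
Hypothesis cX : compact [set: X].

Lemma nbhs_mdist (x : X) (P : set X) :
  nbhs x P <-> exists2 r : R, 0 < r & forall y, mdist x y < r -> P y.
Proof.
split=> [|[r r0 rP]].
  move=> /nbhs_ballP[r /= r0 rP]; exists r => // y xy.
  by apply: rP; rewrite ballEmdist.
by apply/nbhs_ballP; exists r => //= y; rewrite ballEmdist /=; exact: rP.
Qed.

Lemma continuous_mdist (f : X -> R) : continuous f <->
  forall x (e : R), 0 < e ->
    exists2 r : R, 0 < r & forall y, mdist x y < r -> `|f x - f y| < e.
Proof.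
split=> [cf x e e0|cf x].
  have /cvgrPdist_lt/(_ e e0) := cf x.
  by move=> /nbhs_mdist.
by apply/cvgrPdist_lt => e e0; apply/nbhs_mdist; exact: cf.
Qed.

Lemma compact_uniformly_continuous (f : X -> R) (e : R) : continuous f ->
  0 < e -> exists2 d : R, 0 < d & forall x y, mdist x y < d -> `|f x - f y| < e.
Proof.
move=> /continuous_mdist cf e0.
(* A near covering along the filter of small positive radii plays the role of a Lebesgue number. *)
have /compact_near_coveringP/(_ R (0^'+)
  (fun d x => forall y, mdist x y < d -> `|f x - f y| < e) _) := cX.
case=> [x _|].
  have [r r0 rf] := cf x (e / 2) (divr_gt0 e0 (ltr0n _ 2)).
  exists ([set y | mdist x y < r / 2], [set d | d < r / 2]).
    split=> /=; first by apply/nbhs_mdist; exists (r / 2) => //; rewrite divr_gt0.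
    by apply: nbhs_right_lt; rewrite divr_gt0.
  move=> [y d] /= [xy dr] z yz.
  have xz : mdist x z < r.
    by rewrite (le_lt_trans (metric_triangle x y z))//; lra.
  have := rf y ltac:(lra); have := rf z xz; rewrite (distrC (f x) (f y)).
  move=> h1 h2; rewrite (le_lt_trans (ler_distD (f x) _ _))//; lra.
move=> d /= d0 /(_ (d / 2)).
have d20 : 0 < d / 2 by rewrite divr_gt0.
rewrite /ball /= sub0r normrN gtr0_norm// => /(_ _ d20) H.
by exists (d / 2) => // x y; apply: H => //; lra.
Qed.

Lemma compact_continuous_bounded (f : X -> R) : continuous f ->
  exists2 M : R, 0 < M & forall x, `|f x| <= M.
Proof.
move=> cf.
have : compact (f @` setT).
  by apply: continuous_compact => //; exact/continuous_subspaceT.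
move=> /compact_bounded[M [_ /(_ (Num.max M 0 + 1))]] MP.
exists (Num.max M 0 + 1); first by rewrite ltr_pwDr// le_max lexx orbT.
by move=> x; apply: MP => /=; [rewrite ltr_pwDr// le_max lexx|exists x].
Qed.

Lemma finite_net (r : R) : 0 < r ->
  exists s : seq X, forall x, exists2 p, p \in s & mdist x p < r.
Proof.
move=> r0; have := cX; rewrite compact_cover.
move=> /(_ X setT (fun p => [set y | mdist p y < r]))[||D _ DX].
- move=> p _; rewrite openE => y /= py; apply/nbhs_mdist.
  exists (r - mdist p y); first by rewrite subr_gt0.
  move=> z yz /=.
  by rewrite (le_lt_trans (metric_triangle p y z))// -ltrBrDl.
- by move=> x _; exists x => //=; rewrite mdistxx.
exists (enum_fset D) => x; have [p /= pD] := DX x I.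
by rewrite /= metric_sym => px; exists p.
Qed.

(* Maxima of finitely many cones with apex in a countable dense set and rational
   height: every continuous function is a uniform limit of such functions. *)
Lemma continuous_separable : exists F : nat -> X -> R,
  (forall i, continuous (F i)) /\
  forall (f : X -> R) (e : R), continuous f -> 0 < e ->
    exists i, forall x, `|f x - F i x| < e.
Proof.
have /choice[s sP] : forall k : nat, exists s : seq X,
    forall x, exists2 p, p \in s & mdist x p < k.+1%:R^-1.
  by move=> k; apply: finite_net; rewrite invr_gt0.
pose q (a : nat * nat) := nth point (s a.1) a.2.
pose cone (K : nat) (a : rat * (nat * nat)) x : R :=
  ratr a.1 - K%:R * mdist x (q a.2).
pose G (b : nat * seq (rat * (nat * nat))) x : R :=
  foldr (fun a acc => Num.max (cone b.1 a x) acc) (- b.1%:R) b.2.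
exists (fun i => if choice.unpickle i is Some b then G b else cst 0).
split=> [i|f e cf e0].
  case: choice.unpickle => [[K l]|]; last by move=> x; exact: cst_continuous.
  rewrite /G /=; elim: l => [x|a l IH x] /=; first exact: cst_continuous.
  apply: continuous_max; last exact: IH.
  apply: cvgB; first exact: cvg_cst.
  apply: cvgM; first exact: cvg_cst.
  apply: (_ : continuous (fun z => mdist z (q a.2))).
  apply/continuous_mdist => {}x d d0; exists d => // y xy.
  rewrite ltr_norml; have := metric_triangle x y (q a.2).
  have := metric_triangle y x (q a.2); rewrite (metric_sym y x); lra.
have [M M0 fM] := compact_continuous_bounded cf.
have [d d0 fd] := compact_uniformly_continuous cf (divr_gt0 e0 (ltr0n _ 4)).
(* K is both slope and floor: K >= M puts the constant -K below f, and K * d >= 2 * M + e pushes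
   every cone below f at distance d from its apex. *)
have [K K0] : exists2 K : nat, M <= K%:R & 2 * M + e <= K%:R * d.
  pose K := maxn (Num.bound M) (Num.bound ((2 * M + e) / d)).
  exists K; rewrite -?ler_pdivrMr//.
    rewrite (le_trans (ltW (archi_boundP (ltW M0))))// ler_nat leq_max.
    by rewrite leqnn.
  rewrite (le_trans (ltW (archi_boundP _)))//.
    by rewrite divr_ge0 ?ltW//; lra.
  by rewrite ler_nat leq_max leqnn orbT.
move=> Kd.
have K1 : 0 < K%:R + 1 :> R by rewrite ltr_wpDl.
have m0 : 0 < Num.min d (e / 4 / (K%:R + 1)) by rewrite lt_min d0 !divr_gt0.
have [k] : exists k : nat, k.+1%:R^-1 < Num.min d (e / 4 / (K%:R + 1)).
  exists (Num.bound (Num.min d (e / 4 / (K%:R + 1)))^-1).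
  rewrite invf_plt ?posrE//.
  rewrite (lt_trans (archi_boundP _)) ?ltr_nat// invr_ge0 ltW//.
rewrite lt_min => /andP[kd ke].
have /choice[rq rqP] : forall i, exists c : rat,
    f (q (k, i)) - e / 4 < ratr c < f (q (k, i)) + e / 4.
  move=> i; have lt_fq : f (q (k, i)) - e / 4 < f (q (k, i)) + e / 4 by lra.
  by have [c] := rat_in_itvoo lt_fq; rewrite in_itv /=; exists c.
pose l := [seq (rq i, (k, i)) | i <- iota 0 (size (s k))].
exists (choice.pickle (K, l)) => x; rewrite choice.pickleK /G /=.
have upper : foldr (fun a acc => Num.max (cone K a x) acc) (- K%:R) l
    <= f x + e / 2.
  suff : all (fun a => cone K a x <= f x + e / 2) l.
    elim: (l) => [_|a l' IH] /=.
      by have := fM x; rewrite ler_norml => /andP[]; lra.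
    by move=> /andP[al /IH]; rewrite ge_max al.
  apply/allP => _ /mapP[i _ ->]; rewrite /cone /=.
  have /andP[_ rqi] := rqP i.
  have [xi|xi] := ltP (mdist x (q (k, i))) d.
    have := fd _ _ xi; rewrite ltr_norml => /andP[h _].
    have : 0 <= K%:R * mdist x (q (k, i)) by rewrite mulr_ge0// mdist_ge0.
    by lra.
  have : K%:R * d <= K%:R * mdist x (q (k, i)) by rewrite ler_wpM2l.
  have := fM x; have := fM (q (k, i)); rewrite !ler_norml => /andP[? ?] /andP[? ?].
  by lra.
have lower : f x - e < foldr (fun a acc => Num.max (cone K a x) acc) (- K%:R) l.
  have [p ps xp] := sP k x.
  have pi : q (k, index p (s k)) = p by rewrite /q /= nth_index.
  set i := index p (s k) in pi.
  have : (rq i, (k, i)) \in l.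
    by apply: map_f; rewrite mem_iota /= index_mem.
  suff : f x - e < cone K (rq i, (k, i)) x.
    elim: (l) => //= a l' IH h; rewrite inE lt_max => /predU1P[<-|/(IH h) ->].
      by rewrite h.
    by rewrite orbT.
  rewrite /cone /=; have := rqP i; rewrite pi => /andP[h _].
  have := fd _ _ (lt_trans xp kd); rewrite ltr_norml => /andP[_ h2].
  have : K%:R * mdist x p <= e / 4.
    rewrite (@le_trans _ _ ((K%:R + 1) * mdist x p))//.
      by rewrite ler_wpM2r ?mdist_ge0//; lra.
    by rewrite mulrC -ler_pdivlMr// ltW// (lt_trans xp ke).
  by lra.
by rewrite ltr_norml; lra.
Qed.

End CompactMetric.

(** * Integrals of continuous functions *)

Section Mean.
Context {R : realType} {X : pmetricType R}.
Hypothesis cX : compact [set: X].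

Definition mean (mu : measures X) (f : X -> R) : R :=
  (\int[(mu : probability (borel X) R)]_x f x)%R.

Lemma open_measurable_borel (U : set X) :
  open U -> measurable (U : set (borel X)).
Proof. exact: sub_sigma_algebra. Qed.

Lemma continuous_measurable (f : X -> R) : continuous f ->
  measurable_fun [set: borel X] (f : borel X -> R).
Proof.
move=> /continuousP cf.
apply: (measurability _ (measurable_realfun.RGenOpens.measurableE R)).
move=> _ [_ [a [b ->] <-]]; rewrite setTI; apply: open_measurable_borel.
exact/cf/interval_open.
Qed.

Lemma continuous_integrable (mu : probability (borel X) R) (f : X -> R) :
  continuous f -> mu.-integrable setT (EFin \o (f : borel X -> R)).
Proof.
move=> cf; apply: measurable_bounded_integrable => //.
- by rewrite [X in (X < _)%E](_ : _ = 1%E) ?ltry//; exact: probability_setT.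
- exact: continuous_measurable.
have [M M0 fM] := compact_continuous_bounded cX cf.
exists M; split; first exact: num_real.
by move=> y My x _; apply: (le_trans (fM x)); exact: ltW.
Qed.

Lemma mean_cst mu (c : R) : mean mu (fun=> c) = c.
Proof.
rewrite /mean Rintegral_cst// [X in fine X](_ : _ = 1%E) ?mulr1//.
exact: probability_setT.
Qed.

Lemma meanD mu (f g : X -> R) : continuous f -> continuous g ->
  mean mu (fun x => f x + g x) = mean mu f + mean mu g.
Proof. by move=> cf cg; apply: RintegralD => //; exact: continuous_integrable. Qed.

Lemma meanB mu (f g : X -> R) : continuous f -> continuous g ->
  mean mu (fun x => f x - g x) = mean mu f - mean mu g.
Proof. by move=> cf cg; apply: RintegralB => //; exact: continuous_integrable. Qed.

Lemma meanZ mu (c : R) (f : X -> R) : continuous f ->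
  mean mu (fun x => c * f x) = c * mean mu f.
Proof. by move=> cf; apply: RintegralZl => //; exact: continuous_integrable. Qed.

Lemma continuous_sum n (f : nat -> X -> R) : (forall i, continuous (f i)) ->
  continuous (fun x => \sum_(i < n) f i x).
Proof.
move=> cf; elim: n => [|n IH] x.
  by under eq_fun do rewrite big_ord0; exact: cvg_cst.
under eq_fun do rewrite big_ord_recr /=.
by apply: cvgD; [exact: IH|exact: cf].
Qed.

Lemma mean_sum mu n (f : nat -> X -> R) : (forall i, continuous (f i)) ->
  mean mu (fun x => \sum_(i < n) f i x) = \sum_(i < n) mean mu (f i).
Proof.
move=> cf; elim: n => [|n IH].
  by rewrite big_ord0 -[RHS](mean_cst mu); congr mean; apply/funext => x;
    rewrite big_ord0.
rewrite big_ord_recr /= -IH -meanD//; last exact: continuous_sum.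
by congr mean; apply/funext => x; rewrite big_ord_recr.
Qed.

Lemma mean_le mu (f g : X -> R) : continuous f -> continuous g ->
  (forall x, f x <= g x) -> mean mu f <= mean mu g.
Proof.
by move=> cf cg fg; apply: le_Rintegral => //; exact: continuous_integrable.
Qed.

Lemma mean_dist_le mu (f g : X -> R) (e : R) : continuous f -> continuous g ->
  (forall x, `|f x - g x| <= e) -> `|mean mu f - mean mu g| <= e.
Proof.
move=> cf cg fge; rewrite -meanB// ler_norml.
have cfg : continuous (fun x => f x - g x) by move=> x; apply: cvgB; [exact: cf|exact: cg].
rewrite -[X in X <= _ <= _](mean_cst mu) -[X in _ <= _ <= X](mean_cst mu).
by apply/andP; split; apply: mean_le => //; try exact: cst_continuous;
  move=> x; have := fge x; rewrite ler_norml => /andP[].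
Qed.

Lemma mean_norm_le mu (f : X -> R) (M : R) : continuous f ->
  (forall x, `|f x| <= M) -> `|mean mu f| <= M.
Proof.
move=> cf fM; have := @mean_dist_le mu f (fun=> 0) M cf.
rewrite mean_cst subr0; apply=> [|x]; first exact: cst_continuous.
by rewrite subr0.
Qed.

(** The topology is initial for a map into a product, so convergence can be tested on one function
    at a time. General filters cover both sequences and neighbourhood filters. *)
Lemma cvg_measures (F : set_system (measures X)) (mu : measures X) : Filter F ->
  F --> mu <->
  forall f : X -> R, continuous f -> mean nu f @[nu --> F] --> mean mu f.
Proof.
move=> FF; split=> [Fmu f cf|H].
  have c1 : {for mu, continuous (@integrals R X : measures X -> _)}.
    exact: initial_continuous.
  have c2 := @proj_continuous _ (fun=> R) (mkcts cf : continuousType X R).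
  have : {for mu, continuous (proj (mkcts cf : continuousType X R) \o
     (@integrals R X : measures X -> _))}.
    by apply: continuous_comp; [exact: c1|exact: c2].
  exact: (cvg_comp _ _ Fmu).
have : (@integrals R X) nu @[nu --> F] --> (integrals mu : {ptws continuousType X R -> R}).
  apply/cvg_sup => f A /= [_ [[B Bop <-] Bf] sBA].
  have nB : nbhs (mean mu f) B by apply: open_nbhs_nbhs.
  have := H f (@cts_fun _ _ f) B nB; rewrite /= !nbhs_filterE.
  by apply: (@filterS _ F _ _ _ _) => nu; exact: sBA.
move=> H2 A /= [_ [[B Bop <-] Bfs sBfA]].
have : nbhs (integrals mu) B by rewrite nbhsE; exists B.
move=> /H2; rewrite /= !nbhs_filterE.
by apply: (@filterS _ F _ _ _ _) => nu; exact: sBfA.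
Qed.

Lemma mean_continuous (f : X -> R) : continuous f ->
  continuous (fun mu : measures X => mean mu f).
Proof.
move=> cf mu; have /cvg_measures : nbhs mu --> mu by exact: cvg_id.
by apply.
Qed.

Lemma mean_empirical (T : X -> X) x n (f : X -> R) : continuous f ->
  mean (empirical_measure T x n) f = (\sum_(j < n.+1) f (iter j T x)) / n.+1%:R.
Proof.
move=> cf; have [M M0 fM] := compact_continuous_bounded cX cf.
(* Integrals against sums and multiples of measures are computed for nonnegative integrands; adding
   the bound M to f reduces to this case. *)
suff pos (g : X -> R) : continuous g -> (forall x, 0 <= g x) ->
    mean (empirical_measure T x n) g = (\sum_(j < n.+1) g (iter j T x)) / n.+1%:R.
  have cM : continuous (fun x : X => M + f x).
    by move=> y; apply: cvgD; [exact: cvg_cst|exact: cf].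
  have := pos _ cM; rewrite meanD ?mean_cst//; last exact: cst_continuous.
  move=> /(_ _)/(canRL (addKr _)) ->; last first.
    by move=> y; have := fM y; rewrite ler_norml => /andP[]; lra.
  rewrite big_split /= sumr_const card_ord -(mulr_natr M).
  by rewrite mulrDl mulfK ?addKr.
move=> cg g0; rewrite /mean /Rintegral /empirical_measure /= /empirical.
have mg := continuous_measurable cg.
have mg' : measurable_fun [set: borel X] (EFin \o (g : borel X -> R)).
  exact/measurable_EFinP.
rewrite ge0_integral_mscale//= ?ge0_integral_measure_sum//=; last 2 first.
- by move=> y _; rewrite lee_fin.
- by move=> y _; rewrite lee_fin.
under eq_bigr do rewrite integral_dirac//= diracT mul1e.
by rewrite sumEFin -EFinM /= mulrC.
Qed.

Lemma continuous_borel_measurable (T : X -> X) : continuous T ->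
  measurable_fun [set: borel X] (T : borel X -> borel X).
Proof.
move=> /continuousP cT.
apply: (@measurability _ _ (borel X) (borel X) setT T (@open X)) => //.
move=> _ [U oU <-]; rewrite setTI; apply: open_measurable_borel; exact: cT.
Qed.

Lemma mean_invariant (T : X -> X) mu (f : X -> R) : continuous T ->
  invariant_measures T mu -> continuous f -> mean mu (f \o T) = mean mu f.
Proof.
move=> cT imu cf; rewrite /mean /Rintegral; congr fine.
have mT := continuous_borel_measurable cT.
have mf : measurable_fun [set: borel X] (EFin \o (f : borel X -> R)).
  by apply/measurable_EFinP; exact: continuous_measurable.
transitivity (\int[pushforward (mu : probability (borel X) R)
    (T : borel X -> borel X)]_x (f x)%:E)%E.
  have cfT : continuous (f \o T) by move=> x; apply: continuous_comp; [exact: cT|exact: cf].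
  by rewrite (integral_pushforward mT mf (continuous_integrable mu cfT) measurableT).
by apply: eq_measure_integral => A mA _; exact: imu.
Qed.

Lemma continuous_dist_closed (F : set X) : closed F -> F !=set0 ->
  exists d : X -> R, [/\ continuous d, (forall x, 0 <= d x), (forall x, F x -> d x = 0)
    & forall x, ~ F x -> 0 < d x].
Proof.
move=> clF [p Fp].
pose S x := [set mdist x z | z in F].
have hS x : has_inf (S x).
  by split; [exists (mdist x p), p|exists 0 => _ [z _ <-]; exact: mdist_ge0].
have d0 x : 0 <= inf (S x).
  by apply: lb_le_inf => [|_ [z _ <-]]; [exists (mdist x p), p|exact: mdist_ge0].
exists (fun x => inf (S x)); split=> //.
- apply/continuous_mdist => x e e0; exists e => // y xy.
  have le x' y' : inf (S x') <= mdist x' y' + inf (S y').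
    rewrite -lerBlDl; apply: lb_le_inf; first by exists (mdist y' p), p.
    move=> _ [z Fz <-]; rewrite lerBlDl (le_trans _ (metric_triangle x' y' z))//.
    by apply: ge_inf; [case: (hS x')|exists z].
  by have := le x y; have := le y x; rewrite (metric_sym y x) ltr_norml; lra.
- move=> x Fx; apply/eqP; rewrite eq_le d0 andbT.
  by apply: ge_inf; [case: (hS x)|exists x => //; exact: mdistxx].
- move=> x nFx.
  have : nbhs x (~` F) by apply: open_nbhs_nbhs; split=> //; exact: closed_openC.
  move=> /nbhs_mdist[r r0 rF].
  rewrite (lt_le_trans r0)//; apply: lb_le_inf; first by exists (mdist x p), p.
  by move=> _ [z Fz <-]; rewrite leNgt; apply/negP => /rF; exact.
Qed.

(** With d the distance to the complement of an open set U, the functions min(1, n d) increase to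
    the indicator of U. Monotone convergence gives equality on open sets, a generating family stable
    under intersection. *)
Lemma measure_eq_mean (mu nu : probability (borel X) R) :
  (forall f : X -> R, continuous f -> mean mu f = mean nu f) ->
  forall A, measurable A -> mu A = nu A.
Proof.
move=> munu.
have cmin n (d : X -> R) : continuous d ->
    continuous (fun x => Num.min 1 (n%:R * d x)).
  move=> cd x; have c1 : {for x, continuous (cst (1 : R) : X -> R)} by exact: cst_continuous.
  have c2 : {for x, continuous (fun x => n%:R * d x)}.
    by apply: cvgM; [exact: cvg_cst|exact: cd].
  exact: (continuous_min c1 c2).
suff mono (P : probability (borel X) R) (U : set X) (d : X -> R) :
    continuous d -> (forall x, 0 <= d x) -> (forall x, ~ U x -> d x = 0) ->
    (forall x, U x -> 0 < d x) -> open U ->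
    (fun n => (mean P (fun x => Num.min 1 (n%:R * d x)))%:E) @ \oo --> P U.
  apply: (@measure_unique _ R (borel X) (@open X) (fun=> setT) _ _ _ _ mu nu) => //.
  - by move=> A B oA oB; exact: openI.
  - by move=> _; exact: openT.
  - by rewrite bigcup_const.
  - move=> U oU; have [U0|nU] := pselect (~` U !=set0); last first.
      have -> : U = setT.
        by apply/seteqP; split=> // x _; apply: contrapT => nUx; apply: nU; exists x.
      exact: etrans (probability_setT mu) (esym (probability_setT nu)).
    have [d [cd d0 dF dU]] := continuous_dist_closed (open_closedC oU) U0.
    have dU' x : U x -> 0 < d x by move=> Ux; apply: dU; exact.
    have := mono mu U d cd d0 dF dU' oU; have := mono nu U d cd d0 dF dU' oU.
    have -> : (fun n => (mean nu (fun x => Num.min 1 (n%:R * d x)))%:E) =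
        (fun n => (mean mu (fun x => Num.min 1 (n%:R * d x)))%:E).
      by apply/funext => n; rewrite munu//; exact: cmin.
    by move=> h1 h2; apply: (cvg_unique _ h2 h1); exact: ereal_hausdorff.
  - by move=> _; rewrite [X in (X < _)%E](_ : _ = 1%E) ?ltry//; exact: probability_setT.
move=> cd d0 dF dU oU.
have -> : P U = (\int[P]_x limn (fun n => (Num.min 1 (n%:R * d x))%:E))%E.
  rewrite -[in LHS](setIT U) -integral_indic//; last exact: open_measurable_borel.
  apply: eq_integral => x _; apply/esym/cvg_lim => //.
  have [Ux|nUx] := pselect (U x).
    rewrite indicE mem_set//; apply: cvg_near_cst.
    exists (Num.bound (d x)^-1) => // n /= nd.
    rewrite min_l// -ler_pdivrMr ?dU// div1r (le_trans (ltW (archi_boundP _)))//.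
      by rewrite invr_ge0.
    by rewrite ler_nat.
  rewrite indicE memNset// dF//.
  under eq_fun do rewrite mulr0 min_r//; exact: cvg_cst.
under eq_fun => n.
  rewrite /mean /Rintegral fineK; last first.
    exact: (integrable_fin_num measurableT (continuous_integrable P (cmin n d cd))).
  over.
apply: cvg_monotone_convergence => //.
- by move=> n; apply/measurable_EFinP; exact: (continuous_measurable (cmin n d cd)).
- by move=> n x _; rewrite lee_fin le_min ler01 mulr_ge0.
- move=> x _ m n mn; rewrite lee_fin le_min ge_min lexx /= ge_min.
  by rewrite ler_wpM2r ?ler_nat// orbT.
Qed.

(** Continuous functions do not distinguish mu from its image under T, so [measure_eq_mean] applies
    to these two probabilities. *)
Lemma invariant_measures_mean (T : X -> X) (mu : measures X) : continuous T ->
  (forall f : X -> R, continuous f -> mean mu (f \o T) = mean mu f) ->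
  invariant_measures T mu.
Proof.
move=> cT muT.
have mT := continuous_borel_measurable cT.
pose muP : probability (borel X) R := mu.
pose nu := pushforward muP (T : borel X -> borel X).
pose nuP := distribution muP (mfun_Sub (mem_set mT)).
move=> A mA.
have -> : muP A = nuP A; last by [].
apply: measure_eq_mean => // f cf; rewrite -muT// /mean /Rintegral.
congr fine; apply/esym.
have mf : measurable_fun [set: borel X] (EFin \o (f : borel X -> R)).
  by apply/measurable_EFinP; exact: continuous_measurable.
have cfT : continuous (f \o T) by move=> x; apply: continuous_comp; [exact: cT|exact: cf].
by rewrite (integral_pushforward mT mf (continuous_integrable mu cfT) measurableT).
Qed.

End Mean.

(** * Representation of positive functionals *)

Definition agree {T : Type} (n : nat) (a b : nat -> T) : Prop :=
  forall i, (i < n)%N -> a i = b i.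

Lemma agree_refl {T : Type} n (a : nat -> T) : agree n a a. Proof. by []. Qed.

Lemma agree_sym {T : Type} n (a b : nat -> T) : agree n a b -> agree n b a.
Proof. by move=> ab i /ab. Qed.

Lemma agree_trans {T : Type} n (b a c : nat -> T) : agree n a b -> agree n b c -> agree n a c.
Proof. by move=> ab bc i ni; rewrite ab ?bc. Qed.

Lemma agree_le {T : Type} m n (a b : nat -> T) : (m <= n)%N -> agree n a b -> agree m a b.
Proof. by move=> mn ab i im; apply: ab; exact: leq_trans mn. Qed.

Definition determined (n : nat) (A : set (nat -> bool)) : Prop :=
  forall a b, agree n a b -> A a -> A b.

(** A separate name, so that the algebra attached to it contains only the finitely determined sets;
    the generated sigma-algebra is carried by [cylinder_sigma]. *)
Definition cylinders : Type := cantor_space.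

Definition finitely_determined : set (set cylinders) :=
  [set A | exists n, determined n A].

Fact cylinders_display : measure_display. Proof. exact: default_measure_display. Qed.

Lemma finitely_determined0 : finitely_determined set0.
Proof. by exists 0%N. Qed.

Lemma finitely_determinedU : setU_closed finitely_determined.
Proof.
move=> A B [m Am] [n Bn]; exists (maxn m n) => a b ab [/Am|/Bn].
  by move=> h; left; apply: h; exact: agree_le (leq_maxl _ _) ab.
by move=> h; right; apply: h; exact: agree_le (leq_maxr _ _) ab.
Qed.

Lemma finitely_determinedC : setC_closed finitely_determined.
Proof.
by move=> A [m Am]; exists m => a b ab nAa /(Am b a (agree_sym ab)).
Qed.

HB.instance Definition _ := Pointed.on cylinders.
HB.instance Definition _ := isAlgebraOfSets.Build cylinders_display cylinders
  finitely_determined0 finitely_determinedU finitely_determinedC.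

(** Otherwise points outside U that agree with a on longer and longer prefixes would converge to
    a. *)
Lemma cylinder_nbhs (a : cantor_space) (U : set cantor_space) :
  nbhs a U -> exists n, forall b, agree n a b -> U b.
Proof.
move=> aU; apply: contrapT => nH.
have /choice[c cP] : forall n, exists b, agree n a b /\ ~ U b.
  move=> n; apply: contrapT => nb; apply: nH; exists n => b ab.
  by apply: contrapT => nUb; apply: nb; exists b.
have : (c : nat -> cantor_space) @ \oo --> a.
  apply/cvg_sup => i A /= [_ [[B oB <-] /= Bf] sBA].
  exists i.+1 => // n /= ni; apply: sBA => /=; rewrite /proj.
  by have [/(_ i ni) <-] := cP n.
move=> /(_ _ aU)[N _ /(_ N (leqnn N))] /=.
by have [] := cP N.
Qed.

Lemma nbhs_cylinder n (a : cantor_space) : nbhs a [set b | agree n a b].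
Proof.
elim: n => [|n IH]; first by apply: filterS filterT.
have h : nbhs a (proj n @^-1` [set a n]).
  have c : continuous (proj n : cantor_space -> bool) by exact: proj_continuous.
  by apply: (c a [set a n]); exact: discrete_set1.
apply: filterS2 IH h => b ab /= anb i; rewrite ltnS leq_eqVlt.
by move=> /predU1P[->//|]; exact: ab.
Qed.

Lemma cantor_uniformly_continuous (R : realType) (h : cantor_space -> R) (e : R) :
  continuous h -> 0 < e -> exists n, forall a b, agree n a b -> `|h a - h b| < e.
Proof.
move=> ch e0.
have /compact_near_coveringP/(_ nat \oo
  (fun n a => forall b, agree n a b -> `|h a - h b| < e) _) := cantor_space_compact.
case=> [a _|N _ /(_ N (leqnn N)) H]; last first.
  by exists N => a b; exact: H.
have /cvgrPdist_lt/(_ (e / 2) (divr_gt0 e0 (ltr0n _ 2))) := ch a.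
move=> /cylinder_nbhs[n an].
exists ([set b | agree n a b], [set m | (n <= m)%N]).
  by split; [exact: nbhs_cylinder|exists n].
move=> [b m] /= [ab nm] c /(agree_le nm) bc.
have := an _ ab; have := an _ (agree_trans ab bc); rewrite (distrC (h a) (h b)).
by move=> h1 h2; rewrite (le_lt_trans (ler_distD (h a) _ _))//; lra.
Qed.

Definition bounded_fn {T : Type} {R : realType} (h : T -> R) :=
  exists M, forall x, `|h x| <= M.

Lemma bounded_indic {T : Type} {R : realType} (A : set T) :
  bounded_fn (\1_A : T -> R).
Proof. by exists 1 => x; rewrite indicE; case: (_ \in _); rewrite ?normr1 ?normr0. Qed.

Lemma bounded_fnD {T : Type} {R : realType} (f g : T -> R) :
  bounded_fn f -> bounded_fn g -> bounded_fn (fun x => f x + g x).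
Proof.
move=> [M fM] [N gN]; exists (M + N) => x.
by rewrite (le_trans (ler_normD _ _))// lerD.
Qed.

Lemma bounded_fnZ {T : Type} {R : realType} c (f : T -> R) :
  bounded_fn f -> bounded_fn (fun x => c * f x).
Proof. by move=> [M fM]; exists (`|c| * M) => x; rewrite normrM ler_wpM2l. Qed.

(** The conditions range over all bounded functions, continuous or not: L is applied to indicators
    of cylinders and to compositions with an arbitrary section of a surjection. *)
Definition positive_normalized {T : Type} {R : realType} (L : (T -> R) -> R) :=
  [/\ L (fun=> 1) = 1,
    (forall f g, bounded_fn f -> bounded_fn g -> L (fun x => f x + g x) = L f + L g),
    (forall c f, bounded_fn f -> L (fun x => c * f x) = c * L f)
    & forall f g, bounded_fn f -> bounded_fn g -> (forall x, f x <= g x) ->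
      L f <= L g].

Section Representation.
Context {R : realType}.
Variable L : (cantor_space -> R) -> R.
Hypothesis LP : positive_normalized L.

Let L1 : L (fun=> 1) = 1. Proof. by case: LP. Qed.
Let LD f g : bounded_fn f -> bounded_fn g -> L (fun x => f x + g x) = L f + L g.
Proof. by case: LP => _ + _ _; exact. Qed.
Let LZ c f : bounded_fn f -> L (fun x => c * f x) = c * L f.
Proof. by case: LP => _ _ + _; exact. Qed.
Let L_le f g : bounded_fn f -> bounded_fn g -> (forall x, f x <= g x) -> L f <= L g.
Proof. by case: LP => _ _ _; exact. Qed.

Definition cylinder_content (A : set cylinders) : \bar R := (L \1_A)%:E.

Let L0 : L (fun=> 0) = 0.
Proof.
have b0 : bounded_fn (fun _ : cantor_space => 0 : R).
  by exists 0 => x; rewrite normr0.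
transitivity (L (fun x => 0 * (fun=> 0 : R) x)); last by rewrite LZ ?mul0r.
by congr L; apply/funext => x; rewrite mul0r.
Qed.

Let content_ge0 A : (0 <= cylinder_content A)%E.
Proof.
rewrite lee_fin -[leLHS]L0; apply: L_le; first by exists 0 => x; rewrite normr0.
  exact: bounded_indic.
by move=> x; rewrite indicE.
Qed.

Let content_semi_additive : measure_function.semi_additive cylinder_content.
Proof.
move=> F n mF tF _; rewrite /cylinder_content.
elim: n => [|n IH].
  rewrite !big_ord0; congr EFin; rewrite -[RHS]L0; congr L.
  by apply/funext => x; rewrite indic0.
rewrite !big_ord_recr /= -IH -EFinD; congr EFin.
rewrite -LD; [|exact: bounded_indic..]; congr L; apply/funext => x.
have [/mem_set xn|xn] := pselect (F n x).
  rewrite !indicE in_setU xn orbT (_ : _ \in _ = false) ?add0r//.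
  apply/negbTE/negP; rewrite inE -bigcup_mkord => -[i /= ni Fix].
  have in_ : i = n by apply: tF => //; exists x; split=> //; exact: set_mem.
  by move: ni; rewrite in_ ltnn.
by rewrite !indicE in_setU (memNset xn) orbF addr0.
Qed.

HB.instance Definition _ := isContent.Build cylinders_display cylinders R
  cylinder_content content_ge0 content_semi_additive.

Lemma determined_closed n (A : set cantor_space) : determined n A -> closed A.
Proof.
move=> nA; rewrite -(setCK A); apply: open_closedC; rewrite openE => a /= nAa.
apply: filterS (nbhs_cylinder n a) => b /= ab Ab; apply: nAa.
exact: nA (agree_sym ab) Ab.
Qed.

Lemma determined_open n (A : set cantor_space) : determined n A -> open A.
Proof.
move=> nA; rewrite openE => a Aa.
by apply: filterS (nbhs_cylinder n a) => b /= ab; exact: nA ab Aa.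
Qed.

(** Finitely determined sets are compact and open, so a countable cover has a finite subcover and
    finite subadditivity is enough. *)
Let content_sigma_subadditive :
  measurable_subset_sigma_subadditive cylinder_content.
Proof.
move=> A F mF [n nA] AF.
have cA : compact (A : set cantor_space).
  rewrite -(setTI A); apply: compact_closedI; first exact: cantor_space_compact.
  exact: determined_closed nA.
have := cA; rewrite compact_cover => /(_ nat setT (F : nat -> set cantor_space)).
case=> [i _|x /AF[i _ Fi]|D _ AD]; first by have [m] := mF i; exact: determined_open.
  by exists i.
have [N NP] : exists N : nat, forall i, i \in D -> (i < N)%N.
  exists (\max_(i <- D) i).+1 => i iD; rewrite ltnS.
  by rewrite (big_rem i)//= leq_maxl.
apply: (@le_trans _ _ (\sum_(i < N) cylinder_content (F i))%E); last first.
  by rewrite -(big_mkord xpredT (fun i => cylinder_content (F i)));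
    apply: nneseries_lim_ge.
rewrite sumEFin lee_fin.
have sumL k : bounded_fn (fun x => \sum_(i < k) \1_(F i) x : R) /\
    \sum_(i < k) L \1_(F i) = L (fun x => \sum_(i < k) \1_(F i) x).
  elim: k => [|k [bk IH]].
    split; first by exists 0 => x; rewrite big_ord0 normr0.
    by rewrite big_ord0 -L0; congr L; apply/funext => x; rewrite big_ord0.
  rewrite big_ord_recr /= IH -LD//; last exact: bounded_indic.
  rewrite (_ : (fun x => \sum_(i < k.+1) _) = (fun x => \sum_(i < k) \1_(F i) x + \1_(F k) x)).
    by split=> //; apply: bounded_fnD => //; exact: bounded_indic.
  by apply/funext => x; rewrite big_ord_recr.
have [bN ->] := sumL N; apply: L_le => //; first exact: bounded_indic.
move=> x; rewrite indicE; have [/set_mem /AD[i iD Fi]|_] := boolP (x \in A).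
  rewrite (bigD1 (Ordinal (NP i iD)))//= indicE mem_set//= lerDl.
  by apply: sumr_ge0 => j _; rewrite indicE.
by apply: sumr_ge0 => j _; rewrite indicE.
Qed.

HB.instance Definition _ := Content_SigmaSubAdditive_isMeasure.Build
  cylinders_display R cylinders cylinder_content content_sigma_subadditive.

Definition cylinder_sigma : Type :=
  g_sigma_algebraType (@measurable _ cylinders).
HB.instance Definition _ := Measurable.copy cylinder_sigma
  (g_sigma_algebraType (@measurable _ cylinders)).

Definition cantor_measure : set cylinder_sigma -> \bar R :=
  measure_extension cylinder_content.
HB.instance Definition _ := Measure.on cantor_measure.

Let cantor_measureE (A : set cylinders) : measurable A ->
  cantor_measure A = (L \1_A)%:E.
Proof. by move=> mA; rewrite /cantor_measure /measure_extension measurable_mu_extE. Qed.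

Let cantor_measureT : cantor_measure setT = 1%E.
Proof.
rewrite cantor_measureE; last exact: measurableT.
by congr EFin; rewrite -[RHS]L1; congr L; apply/funext => x; rewrite indicT.
Qed.

HB.instance Definition _ :=
  Measure_isProbability.Build _ _ _ cantor_measure cantor_measureT.

Lemma determined_measurable n (A : set cantor_space) :
  determined n A -> measurable (A : set cylinder_sigma).
Proof. by move=> nA; apply: sub_sigma_algebra; exists n. Qed.

Lemma cantor_open_measurable (U : set cantor_space) :
  open U -> measurable (U : set cylinder_sigma).
Proof.
move=> oU.
have -> : U = \bigcup_n [set a | forall b, agree n a b -> U b].
  apply/seteqP; split=> [a Ua|a [n _]]; last by apply; exact: agree_refl.
  have : nbhs a U by exact: open_nbhs_nbhs.
  by move=> /cylinder_nbhs[n an]; exists n.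
apply: (@bigcupT_measurable _ cylinder_sigma) => n.
apply: (@determined_measurable n) => a b ab aU c bc.
exact/aU/(agree_trans ab).
Qed.

Lemma cantor_continuous_measurable (h : cantor_space -> R) : continuous h ->
  measurable_fun setT (h : cylinder_sigma -> R).
Proof.
move=> /continuousP ch.
apply: (measurability _ (RGenOpens.measurableE R)).
move=> _ [_ [a [b ->] <-]]; rewrite setTI; apply: cantor_open_measurable.
exact/ch/interval_open.
Qed.

Let integrable_bounded (h : cylinder_sigma -> R) :
  measurable_fun setT h -> bounded_fn h ->
  (cantor_measure : {measure set _ -> \bar R}).-integrable setT (EFin \o h).
Proof.
move=> mh [M hM]; apply: measurable_bounded_integrable => //.
  by rewrite [X in (X < _)%E](_ : _ = 1%E) ?ltry//; exact: cantor_measureT.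
exists M; split; first exact: num_real.
by move=> y My x _; apply: (le_trans (hM x)); exact: ltW.
Qed.

Let L_dist_le f g e : bounded_fn f -> bounded_fn g ->
  (forall x, `|f x - g x| <= e) -> `|L f - L g| <= e.
Proof.
move=> bf bg fge.
have be : bounded_fn (fun _ : cantor_space => e) by exists `|e|.
have Le : L (fun=> e) = e.
  have b1 : bounded_fn (fun _ : cantor_space => 1 : R) by exists 1 => x; rewrite normr1.
  transitivity (L (fun=> e * 1)); first by rewrite mulr1.
  by rewrite LZ// L1 mulr1.
have h u v : bounded_fn u -> bounded_fn v -> (forall x, `|u x - v x| <= e) ->
    L u - L v <= e.
  move=> bu bv uv; rewrite lerBlDr -{1}Le -LD//; apply: L_le => //.
    exact: bounded_fnD.
  by move=> x; have := uv x; rewrite ler_norml => /andP[_]; lra.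
rewrite ler_norml; apply/andP; split; last exact: h.
by rewrite lerNl opprB; apply: h => // x; rewrite distrC.
Qed.

Lemma cantor_integral_le_dist (f g : cylinder_sigma -> R) e :
  measurable_fun setT f -> measurable_fun setT g ->
  bounded_fn f -> bounded_fn g ->
  (forall x, `|f x - g x| <= e) ->
  `|(\int[cantor_measure]_x f x)%R - (\int[cantor_measure]_x g x)%R| <= e.
Proof.
move=> mf mg bf bg fge.
have If := integrable_bounded mf bf; have Ig := integrable_bounded mg bg.
rewrite -RintegralB//.
have Ifg := integrableB measurableT If Ig.
apply: (le_trans (le_normr_Rintegral _ _)) => //.
rewrite -[leRHS]mulr1 -[in leRHS](_ : fine (cantor_measure setT) = 1); last first.
  by rewrite cantor_measureT.
rewrite -Rintegral_cst//; apply: le_Rintegral => //.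
- by apply: integrable_norm.
- apply: integrable_bounded => //.
  by exists `|e|.
Qed.

(** h is a finite linear combination of indicators of cylinders, one for each word of length n, and
    on these the measure is given by L. *)
Let integral_determined n (h : cantor_space -> R) :
  (forall a b, agree n a b -> h a = h b) ->
  [/\ bounded_fn h, measurable_fun setT (h : cylinder_sigma -> R) &
    (\int[cantor_measure]_x h x)%R = L h].
Proof.
move=> nh.
pose ext (v : n.-tuple bool) : cantor_space := fun i => nth false v i.
pose cyl v : set cylinders := [set c | agree n c (ext v)].
have mcyl v : measurable (cyl v).
  by exists n => a b ab; exact: agree_trans (agree_sym ab).
have -> : h = (fun c => \sum_(v <- enum {: n.-tuple bool}) h (ext v) * \1_(cyl v) c).
  apply/funext => c; pose v := [tuple c (i : nat) | i < n].
  have cv : agree n c (ext v).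
    by move=> i ni; rewrite /ext (nth_map (Ordinal ni)) ?size_enum_ord// nth_enum_ord.
  rewrite big_enum /= (bigD1 v)//= indicE mem_set//= mulr1 big1 ?addr0.
    exact: nh.
  move=> w wv; rewrite indicE memNset ?mulr0// => cw.
  move/negP: wv; apply; apply/eqP/eq_from_tnth => i.
  rewrite (tnth_nth false) [RHS](tnth_nth false).
  by have := cw i (ltn_ord i); have := cv i (ltn_ord i); rewrite /ext => <-.
elim: (enum _) => [|v s [bs ms IH]].
  have -> : (fun c : cantor_space => \sum_(v <- [::]) h (ext v) * \1_(cyl v) c) = fun=> 0 : R.
    by apply/funext => c; rewrite big_nil.
  split; [by exists 0 => x; rewrite normr0|exact: measurable_cst|].
  by rewrite L0 Rintegral_cst// mul0r.
under eq_fun do rewrite big_cons.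
have bv : bounded_fn (fun c : cantor_space => h (ext v) * \1_(cyl v) c : R).
  by apply: bounded_fnZ; exact: bounded_indic.
have mI : measurable_fun setT (\1_(cyl v) : cylinder_sigma -> R).
  by apply: measurable_indic; apply: sub_sigma_algebra; exact: mcyl.
have mv : measurable_fun setT (fun c : cylinder_sigma => h (ext v) * \1_(cyl v) c : R).
  by apply: measurable_funM => //; exact: measurable_cst.
split; [exact: bounded_fnD|exact: measurable_funD|].
rewrite LD// -IH RintegralD//; [|exact: integrable_bounded..].
congr (_ + _); rewrite LZ; last exact: bounded_indic.
rewrite RintegralZl//; last by apply: integrable_bounded => //; exact: bounded_indic.
congr (_ * _); rewrite /Rintegral integral_indic//; last first.
  by apply: sub_sigma_algebra; exact: mcyl.
by rewrite setIT; exact: (congr1 fine (cantor_measureE (mcyl v))).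
Qed.

Lemma cantor_continuous_bounded (h : cantor_space -> R) :
  continuous h -> bounded_fn h.
Proof.
move=> ch; have [n nh] := cantor_uniformly_continuous ch ltr01.
(* Erasing the coordinates from n on turns h into a function of n coordinates that stays within 1 of
   h. *)
pose rep (c : cantor_space) : cantor_space := fun i => (i < n)%N && c i.
have rep_agree c : agree n c (rep c) by move=> i ni; rewrite /rep ni.
have [|[M hM] _ _] := @integral_determined n (h \o rep).
  move=> a b ab /=; congr h; apply/funext => i; rewrite /rep.
  by case: ltnP => //= /ab.
exists (M + 1) => x; have := nh _ _ (rep_agree x); have := hM x => /=.
rewrite -{2}(subrK (h (rep x)) (h x)) => h1 h2.
by rewrite (le_trans (ler_normD _ _))// addrC lerD// ltW.
Qed.

(** Both sides are continuous for the uniform norm and agree on functions of finitely many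
    coordinates, which approximate h uniformly. *)
Lemma cantor_integral (h : cantor_space -> R) : continuous h ->
  (\int[cantor_measure]_x h x)%R = L h.
Proof.
move=> ch; apply/eqP; rewrite -subr_eq0 -normr_le0; apply/ler_addgt0Pl => e e0.
have [n nh] := cantor_uniformly_continuous ch (divr_gt0 e0 (ltr0n _ 2)).
pose rep (c : cantor_space) : cantor_space := fun i => (i < n)%N && c i.
have rep_agree c : agree n c (rep c) by move=> i ni; rewrite /rep ni.
have [|brep mrep Erep] := @integral_determined n (h \o rep).
  move=> a b ab /=; congr h; apply/funext => i; rewrite /rep.
  by case: ltnP => //= /ab.
have bh := cantor_continuous_bounded ch.
have dist x : `|h x - (h \o rep) x| <= e / 2 by apply/ltW/nh.
have := cantor_integral_le_dist (cantor_continuous_measurable ch) mrep bh brep dist.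
have := L_dist_le bh brep dist; rewrite Erep addr0 => h1 h2.
rewrite (le_trans (ler_distD (L (h \o rep)) _ _))// [leRHS](splitr e) lerD//.
by rewrite distrC.
Qed.

End Representation.

(* Pulling a functional on X back along a Borel surjection of the Cantor space
   reduces the Riesz representation theorem to the Cantor space, where every
   finitely additive function on the cylinders is countably additive. *)
Lemma compact_representation {R : realType} {X : pmetricType R}
    (L : (X -> R) -> R) : compact [set: X] -> positive_normalized L ->
  exists mu : measures X, forall f : X -> R, continuous f -> mean mu f = L f.
Proof.
move=> cX [L1 LD LZ L_le].
have [p cp] := cantor_surj cX (@metric_hausdorff R X).
(* An arbitrary section, with no regularity; this is where L must act on discontinuous functions. *)
have /choice[s sP] : forall x : X, exists c : cantor_space, p c = x.
  by move=> x; have [c _ <-] := @surj _ _ _ _ p x I; exists c.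
pose Ls (h : cantor_space -> R) := L (h \o s).
have bs (h : cantor_space -> R) : bounded_fn h -> bounded_fn (h \o s).
  by move=> [M hM]; exists M => x; exact: hM.
have LsP : positive_normalized Ls.
  split=> //.
  - by move=> f g /bs bf /bs bg; exact: LD.
  - by move=> c f /bs bf; exact: LZ.
  - by move=> f g /bs bf /bs bg fg; apply: L_le => // x; exact: fg.
have mp : measurable_fun [set: cylinder_sigma] (p : cylinder_sigma -> borel X).
  apply: (@measurability _ _ cylinder_sigma (borel X) setT p (@open X)) => //.
  move=> _ [U oU <-]; rewrite setTI; apply: cantor_open_measurable.
  by move/continuousP : cp; exact.
pose P : probability cylinder_sigma R := cantor_measure LsP.
pose mu := distribution P (mfun_Sub (mem_set mp)).
exists (mu : probability (borel X) R) => f cf.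
have cfp : continuous (f \o p).
  by move=> c; apply: continuous_comp; [exact: cp|exact: cf].
have -> : L f = Ls (f \o p) by congr L; apply/funext => x /=; rewrite sP.
rewrite -(cantor_integral LsP cfp) /mean /Rintegral; congr fine.
have mf : measurable_fun [set: borel X] (EFin \o (f : borel X -> R)).
  by apply/measurable_EFinP; exact: continuous_measurable.
rewrite (@integral_pushforward _ _ _ _ _ _ mp P setT _ mf)// preimage_setT.
apply: measurable_bounded_integrable => //.
- by rewrite [X in (X < _)%E](_ : _ = 1%E) ?ltry//; exact: probability_setT.
- exact: (cantor_continuous_measurable cfp).
have [M fM] := cantor_continuous_bounded LsP cfp.
exists M; split; first exact: num_real.
by move=> y My x _; apply: (le_trans (fM x)); exact: ltW.
Qed.

(** * Limit measures *)

Lemma increasing_choice (P : nat -> nat -> Prop) :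
  (forall k N, exists2 n, (N <= n)%N & P k n) ->
  exists2 g : nat -> nat, increasing_seq g & forall k, P k (g k).
Proof.
move=> H.
have /choice[h hP] : forall kN : nat * nat, exists n, (kN.2 <= n)%N /\ P kN.1 n.
  by move=> [k N]; have [n Nn Pn] := H k N; exists n.
pose g := fix g k := if k is k'.+1 then h (k, (g k').+1) else h (0, 0)%N.
exists g; last by case=> [|k] /=; [exact: (hP (0, 0)%N).2|exact: (hP (k.+1, _)).2].
apply/increasing_seqP => k.
exact: (hP (k.+1, (g k).+1)).1.
Qed.

Lemma increasing_seq_ge (g : nat -> nat) k : increasing_seq g -> (k <= g k)%N.
Proof.
move=> /increasing_seqP gi; elim: k => // k IH.
exact: leq_ltn_trans IH (gi k).
Qed.

Lemma lt_inv_nat (R : realType) (e : R) : 0 < e -> exists k : nat, k.+1%:R^-1 < e.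
Proof.
move=> e0; exists (Num.bound e^-1); rewrite invf_plt ?posrE//.
by rewrite (lt_trans (archi_boundP _)) ?ltr_nat// invr_ge0 ltW.
Qed.

(** Tolerances have the form 1/(k+1); passing from k to 2k+1 halves them, as the triangle inequality
    for [mean_close] requires. *)
Lemma half_radius (R : realType) k :
  k.+1%:R^-1 = (2 * k + 1).+1%:R^-1 + (2 * k + 1).+1%:R^-1 :> R.
Proof.
rewrite -addnS -[(2 * k + 2)%N]/(2 * k + 2 * 1)%N -mulnDr addn1 natrM invfM.
by rewrite -mulrDl [X in X * _](_ : _ = 1) ?mul1r// -div1r -splitr.
Qed.

Section Dense.
Context {R : realType} {X : pmetricType R}.
Hypothesis cX : compact [set: X].
Variable F : nat -> X -> R.
Hypothesis cF : forall i, continuous (F i).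
Hypothesis dF : forall (f : X -> R) (e : R), continuous f -> 0 < e ->
  exists i, forall x, `|f x - F i x| < e.

(** Countably many entourages in place of a metric on measures; k sets both the number of test
    functions and the tolerance. *)
Definition mean_close (k : nat) (mu nu : measures X) : Prop :=
  forall i, (i < k)%N -> `|mean mu (F i) - mean nu (F i)| < k.+1%:R^-1.

Lemma mean_close_lt (f : X -> R) (e : R) : continuous f -> 0 < e ->
  exists K, forall k mu nu, (K <= k)%N -> mean_close k mu nu ->
    `|mean mu f - mean nu f| < e.
Proof.
move=> cf e0; have e3 : 0 < e / 3 by rewrite divr_gt0.
have [i fi] := dF cf e3; have [m me] := lt_inv_nat e3.
exists (maxn i.+1 m) => k mu nu; rewrite geq_max => /andP[ik mk] /(_ i ik) munu.
have h1 := mean_dist_le cX mu cf (@cF i) (fun x => ltW (fi x)).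
have h2 := mean_dist_le cX nu cf (@cF i) (fun x => ltW (fi x)).
have : k.+1%:R^-1 <= m.+1%:R^-1 :> R by rewrite lef_pV2 ?posrE// ler_nat.
move=> km; move: munu h1 h2; rewrite !ltr_norml !ler_norml.
move: (k.+1%:R^-1) (m.+1%:R^-1) km me => a b km me.
by move=> /andP[? ?] /andP[? ?] /andP[? ?]; apply/andP; split; lra.
Qed.

Lemma cvg_mean_close (u : nat -> measures X) mu :
  (forall k, \forall n \near \oo, mean_close k (u n) mu) -> u @ \oo --> mu.
Proof.
move=> H; apply/cvg_measures => f cf; apply/cvgrPdist_lt => e e0.
have [K KP] := mean_close_lt cf e0.
apply: filterS (H K) => n /= /(KP _ _ _ (leqnn K)).
by rewrite distrC.
Qed.

Lemma mean_close_cvg (u : nat -> measures X) mu k :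
  u @ \oo --> mu -> \forall n \near \oo, mean_close k (u n) mu.
Proof.
move=> /cvg_measures umu.
suff : \forall n \near \oo, forall i : 'I_k,
    `|mean (u n) (F i) - mean mu (F i)| < k.+1%:R^-1.
  by apply: filterS => n /= H i ik; exact: H (Ordinal ik).
apply: filter_forall => i.
have k0 : 0 < k.+1%:R^-1 :> R by rewrite invr_gt0.
have /cvgrPdist_lt/(_ _ k0)[N _ NP] := umu _ (@cF i).
by exists N => // n /NP /=; rewrite distrC.
Qed.

Lemma mean_close_le k l mu nu : (k <= l)%N -> mean_close l mu nu -> mean_close k mu nu.
Proof.
move=> kl h i ik; rewrite (lt_le_trans (h i (leq_trans ik kl)))//.
by rewrite lef_pV2 ?posrE// ler_nat.
Qed.

Lemma mean_close_refl k mu : mean_close k mu mu.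
Proof. by move=> i _; rewrite subrr normr0 invr_gt0. Qed.

Lemma mean_close_sym k mu nu : mean_close k mu nu -> mean_close k nu mu.
Proof. by move=> h i ik; rewrite distrC; exact: h. Qed.

Lemma mean_close_trans k nu mu rho :
  mean_close (2 * k + 1) mu nu -> mean_close (2 * k + 1) nu rho -> mean_close k mu rho.
Proof.
move=> h1 h2 i ik; have ik2 : (i < 2 * k + 1)%N by lia.
by rewrite half_radius (le_lt_trans (ler_distD (mean nu (F i)) _ _))// ltrD// ?h1// h2.
Qed.

Lemma closed_mean_close (V : set (measures X)) mu : closed V ->
  (forall k, exists2 nu, V nu & mean_close k nu mu) -> V mu.
Proof.
move=> clV H.
have /choice[u uP] : forall k, exists nu, V nu /\ mean_close k nu mu.
  by move=> k; have [nu ? ?] := H k; exists nu.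
apply: (@closed_cvg _ _ \oo _ u V clV _ mu).
  by apply: nearW => k; case: (uP k).
apply: cvg_mean_close => k; exists k => // n /= kn.
exact: mean_close_le (uP n).2.
Qed.

Lemma open_mean_close k mu : open [set nu | mean_close k nu mu].
Proof.
have -> : [set nu | mean_close k nu mu] = \bigcap_(i in `I_k)
   ((fun nu => mean nu (F i)) @^-1` ball (mean mu (F i)) k.+1%:R^-1).
  apply/seteqP; split=> nu H i ik.
    by rewrite /= /ball /= distrC; exact: H.
  by have := H i ik; rewrite /= /ball /= distrC.
rewrite bigcap_mkord.
elim/big_ind: _ => [|A B oA oB|i _]; [exact: openT|exact: openI|].
have /continuousP : continuous (fun nu : measures X => mean nu (F i)).
  by apply: mean_continuous.
by apply; exact: ball_open.
Qed.

Section Limits.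
Variable T : X -> X.

(** Removes subsequences from the definition: for the converse, increasing times are chosen so that
    the k-th one is k-close to mu. *)
Lemma limit_measures_close x mu : limit_measures T x mu <->
  forall k N, exists2 n, (N <= n)%N & mean_close k (empirical_measure T x n) mu.
Proof.
split=> [[g gi gmu] k N|H].
  have [M _ MP] := mean_close_cvg k gmu.
  exists (g (maxn M N)); last by apply: MP; rewrite /= leq_maxl.
  by rewrite (leq_trans (leq_maxr M N))// increasing_seq_ge.
have [g gi gP] := increasing_choice H.
exists g => //; apply: cvg_mean_close => k; exists k => // n /= kn.
exact: mean_close_le (gP n).
Qed.

(** Along an ultrafilter that contains A and all tails, the averages of every bounded function
    converge. The limit is a positive functional, hence a measure, and non-strict inequalities valid
    at all times in A survive. *)
Lemma limit_measures_exist x (A : set nat) :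
  (forall N, exists2 n, (N <= n)%N & A n) ->
  exists2 mu, limit_measures T x mu & forall (f : X -> R) c, continuous f ->
    (forall n, A n -> mean (empirical_measure T x n) f <= c) -> mean mu f <= c.
Proof.
move=> AN.
have PF : ProperFilter (within A \oo).
  split; last exact: within_filter.
  by move=> [N _ NP]; have [n Nn An] := AN N; exact: NP n Nn An.
have [U [UU FU]] := ultraFilterLemma PF.
have PU : ProperFilter U by exact: ultra_proper.
(* The averages are written as sums because f may fail to be measurable here. *)
pose W n (f : X -> R) := (\sum_(j < n.+1) f (iter j T x)) / n.+1%:R.
have W_le n f g : (forall x, f x <= g x) -> W n f <= W n g.
  by move=> fg; rewrite ler_wpM2r ?invr_ge0// ler_sum.
have Wcst n c : W n (fun=> c) = c.
  by rewrite /W sumr_const card_ord -(mulr_natr c) mulfK.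
have WD n f g : W n (fun x => f x + g x) = W n f + W n g.
  by rewrite /W big_split mulrDl.
have WZ n c f : W n (fun x => c * f x) = c * W n f.
  by rewrite /W -mulr_sumr mulrA.
have Wcvg f : bounded_fn f -> cvg (W n f @[n --> U]).
  move=> [M fM].
  have cM : compact `[- M, M]%classic by exact: segment_compact.
  case: (cM (W n f @[n --> U])); last first.
    move=> l [_ lP]; apply/cvg_ex; exists l => B lB.
    have [//|UB] := in_ultra_setVsetC ((fun n => W n f) @^-1` B) UU.
    by have [y []] := lP (~` B) B UB lB.
  apply: (@filterE _ U) => n /=; rewrite in_itv /=.
  suff : W n (fun=> - M) <= W n f <= W n (fun=> M) by rewrite !Wcst.
  by apply/andP; split; apply: W_le => y; have := fM y; rewrite ler_norml => /andP[].
pose L f := lim (W n f @[n --> U]).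
have LP : positive_normalized L.
  split=> [|f g bf bg|c f bf|f g bf bg fg].
  - by rewrite /L; under eq_fun do rewrite Wcst; exact: lim_cst.
  - rewrite /L -limD; [|exact: Wcvg..].
    by congr (lim (_ @ U)); apply/funext => n; rewrite WD.
  - have -> : L (fun x => c * f x) = lim (c * W n f @[n --> U]).
      by congr (lim (_ @ U)); apply/funext => n; rewrite WZ.
    by apply/cvg_lim => //; apply: cvgMr; exact: Wcvg.
  - by apply: ler_lim; [exact: Wcvg|exact: Wcvg|apply: filterE => n; exact: W_le].
have [mu muL] := compact_representation cX LP.
have bc (f : X -> R) : continuous f -> bounded_fn f.
  by move=> cf; have [M _ fM] := compact_continuous_bounded cX cf; exists M.
have WE n f : continuous f -> mean (empirical_measure T x n) f = W n f.
  by move=> cf; rewrite mean_empirical.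
exists mu.
  apply/limit_measures_close => k N.
  suff [n []] : exists n, (N <= n)%N /\ mean_close k (empirical_measure T x n) mu by exists n.
  apply: (@filter_ex _ U); apply: filterI.
    apply: FU; exists N => // n /= Nn _; exact: Nn.
  suff : U [set n | forall i : 'I_k, `|W n (F i) - L (F i)| < k.+1%:R^-1].
    apply: filterS => n /= H i ik; rewrite WE// muL//.
    exact: H (Ordinal ik).
  apply: filter_forall => i.
  have k0 : 0 < k.+1%:R^-1 :> R by rewrite invr_gt0.
  have /cvgrPdist_lt/(_ _ k0) := Wcvg _ (bc _ (@cF i)).
  by apply: (@filterS _ U) => n /=; rewrite distrC.
move=> f c cf fc; rewrite muL//; apply: limr_le; first exact/Wcvg/bc.
by apply: FU; apply: nearW => n An; rewrite -WE//; exact: fc.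
Qed.

(** The orbit sums of f and of f \o T differ only in one initial and one final term, so the averages
    differ by at most 2 * M over the length. *)
Lemma limit_measures_invariant x : continuous T ->
  limit_measures T x `<=` invariant_measures T.
Proof.
move=> cT mu [g gi /cvg_measures gmu].
apply: invariant_measures_mean => // f cf.
have cfT : continuous (f \o T).
  by move=> y; apply: continuous_comp; [exact: cT|exact: cf].
apply/eqP; rewrite -subr_eq0; apply/eqP.
have [M M0 fM] := compact_continuous_bounded cX cf.
have h : (mean (empirical_measure T x (g n)) (f \o T) -
         mean (empirical_measure T x (g n)) f) @[n --> \oo] --> (0 : R).
  apply: (@squeeze_cvgr _ _ _ _ (fun n => - (2 * M / n.+1%:R)) (fun n => 2 * M / n.+1%:R)).
  - apply: nearW => n; rewrite -ler_norml !mean_empirical// -mulrBl normrM.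
    rewrite [X in _ * X]ger0_norm ?invr_ge0//.
    apply: ler_pM => //; last first.
      by rewrite lef_pV2 ?posrE// ler_nat ltnS increasing_seq_ge.
    under eq_bigr do rewrite /= -iterS.
    rewrite big_ord_recr [X in _ - X]big_ord_recl /= [X in _ - X]addrC opprD addrACA.
    rewrite -sumrB big1 ?add0r// => [|i _]; last by rewrite subrr.
    have := fM (iter (g n).+1 T x); have := fM x; rewrite /= !ler_norml.
    by move=> /andP[? ?] /andP[? ?]; apply/andP; split; lra.
  - rewrite -oppr0 -(mulr0 (2 * M)); apply: cvgN; apply: cvgMr.
    exact: cvg_harmonic.
  - by rewrite -(mulr0 (2 * M)); apply: cvgMr; exact: cvg_harmonic.
apply: (cvg_unique _ _ h); first exact: Rhausdorff.
by apply: cvgB; [exact: gmu|exact: gmu].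
Qed.

End Limits.
End Dense.

(** * Sequences tending to infinity *)

Lemma increasing_homo (g : nat -> nat) : (forall k, (g k < g k.+1)%N) ->
  {homo g : i j / (i <= j)%N}.
Proof.
by move=> gS; apply: homo_leq => [//|y x z|i]; [exact: leq_trans|exact: ltnW].
Qed.

(** Stage k freezes the values before p k and may change the others, but keeps them above the bound
    of the preceding stage; monotonicity of m carries these bounds to the limit. *)
Lemma fusion (m : nat -> nat) (a : nat -> nat -> nat) (p : nat -> nat) :
  {homo m : i j / (i <= j)%N} ->
  (forall k, (p k < p k.+1)%N) -> (forall k, agree (p k) (a k) (a k.+1)) ->
  (forall k j, (p k <= j)%N -> (m k <= a k.+1 j)%N) ->
  exists c, (forall k, agree (p k) (a k) c) /\
    forall k j, (p k <= j)%N -> (m k <= c j)%N.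
Proof.
move=> mm pS aS mS.
have pm := increasing_homo pS.
have p_ge k : (k <= p k)%N by elim: k => // k /leq_ltn_trans; apply.
have aa k l : (k <= l)%N -> agree (p k) (a k) (a l).
  elim: l => [|l IH]; first by rewrite leqn0 => /eqP ->.
  rewrite leq_eqVlt => /predU1P[->//|]; rewrite ltnS => kl i ik.
  by rewrite (IH kl i ik) aS// (leq_trans ik)// pm.
(* Since n < p n.+1, the value at n is frozen from stage n.+1 on. *)
exists (fun n => a n.+1 n); split=> [k i ik|k j kj].
  have [ki|ik1] := leqP k i.+1; first exact: aa.
  by apply/esym; apply: aa => //; exact: ltnW.
have [jk|kj1] := leqP j k.
  have -> := aa j.+1 k.+1 jk j (p_ge _).
  exact: mS.
have h l : (k < l)%N -> (m k <= a l j)%N.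
  elim: l => // l IH; rewrite ltnS leq_eqVlt => /predU1P[<-|kl]; first exact: mS.
  have [jl|lj] := ltnP j (p l); first by rewrite -aS// IH.
  by rewrite (leq_trans (mm _ _ (ltnW kl)))// mS.
by apply: h; exact: ltnW.
Qed.

Definition tends_on (J : set nat) (a : nat -> nat) : Prop :=
  forall m, exists N, forall j, (N <= j)%N -> J j -> (m <= a j)%N.

(** Openness in the Baire space of sequences of naturals, expressed by prefixes. *)
Definition cylinder_open (O : set (nat -> nat)) : Prop :=
  forall a, O a -> exists p, forall b, agree p a b -> O b.

Section NotSigma3.
Variables (J : set nat) (O : nat -> nat -> set (nat -> nat)).
Hypothesis Jinf : forall N, exists2 j, (N <= j)%N & J j.
Hypothesis oO : forall i k, cylinder_open (O i k).
Hypothesis HO : forall a, tends_on J a <-> exists i, forall k, O i k a.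

Let D (a : nat -> nat) (p m : nat) : set (nat -> nat) :=
  [set b | agree p a b /\ forall j, (p <= j)%N -> (m <= b j)%N].

(* Baire category: otherwise the i-th G_delta would be dense in the closed set
   [D a p m], hence would contain a sequence taking the value m infinitely often
   on J. *)
Let avoid i a p m : exists a' p', [/\ (p < p')%N, D a p m a' &
  forall b, D a' p' m b -> ~ forall k, O i k b].
Proof.
apply: contrapT => nH.
have dense a' p' : (p < p')%N -> D a p m a' ->
    exists2 b, D a' p' m b & forall k, O i k b.
  move=> pp' Da'; apply: contrapT => nb; apply: nH; exists a', p'; split=> // b Db Ob.
  by apply: nb; exists b.
(* Step k extends the prefix so as to enter [O i k] and then fixes the value m at some position j >=
   k of J. *)
have /choice[f fP] : forall s : nat * ((nat -> nat) * nat), exists s' : (nat -> nat) * nat,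
    (p < s.2.2)%N -> D a p m s.2.1 ->
    [/\ (s.2.2 < s'.2)%N, D s.2.1 s.2.2 m s'.1,
      (forall b, agree s'.2 s'.1 b -> O i s.1 b) &
      exists2 j, (s.1 <= j < s'.2)%N & J j /\ s'.1 j = m].
  move=> [k [a' p']] /=.
  have [h1|nh] := pselect ((p < p')%N /\ D a p m a'); last first.
    by exists (a', p') => pp Da; case: nh.
  have [b [ab mb] Ob] := dense a' p' h1.1 h1.2.
  have [q qO] := oO (Ob k); have [j qj Jj] := Jinf (maxn k (maxn p' q)).
  move: qj; rewrite !geq_max => /and3P[kj pj qj].
  exists ((fun n => if (n < j)%N then b n else m), j.+1) => _ _ /=; split.
  - by rewrite ltnS.
  - split=> [n np|n pn]; first by rewrite (leq_trans np pj) ab.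
    by case: ifP => // _; exact: mb.
  - move=> c ac; apply: qO => n nq.
    by rewrite -ac ?(leq_trans nq qj)// ltnS (leq_trans (ltnW nq) qj).
  - by exists j; [rewrite kj ltnS leqnn|rewrite ltnn].
pose a0 n := if (n < p)%N then a n else m.
have Da0 : D a p m a0.
  split=> [n np|n pn]; first by rewrite /a0 np.
  by rewrite /a0 ltnNge pn.
pose s := fix s k := if k is k'.+1 then f (k', s k') else (a0, p.+1).
have sP k : (p < (s k).2)%N /\ D a p m (s k).1.
  elim: k => [|k [pk Dk]]; first by [].
  have [h1 [h2 h3] _ _] := fP (k, s k) pk Dk; split; first exact: ltn_trans h1.
  have [g1 g2] := Dk; split=> [n np|n pn] /=.
    by rewrite g1// h2// (ltn_trans np).
  have [nk|kn] := ltnP n (s k).2; last exact: h3.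
  by rewrite -h2//; exact: g2.
have step k := fP (k, s k) (sP k).1 (sP k).2.
have [||||c [cs _]] := @fusion (fun=> m) (fun k => (s k).1) (fun k => (s k).2).
- by [].
- by move=> k; case: (step k).
- by move=> k; case: (step k) => _ [].
- by move=> k; case: (step k) => _ [].
(* c lies in the i-th intersection, so it should exceed m eventually on J, whereas step N has placed
   a value m beyond N. *)
have /HO/(_ m.+1)[N NP] : exists i, forall k, O i k c.
  by exists i => k; case: (step k) => _ _ + _; apply; exact: cs k.+1.
have [_ _ _ [j /andP[Nj jp] [Jj jm]]] := step N.
by have := NP j Nj Jj; rewrite -(cs N.+1 j jp) jm ltnn.
Qed.

(** Diagonalisation: stage i leaves the i-th intersection for good and raises the lower bound to i.
    The fused sequence tends to infinity but belongs to no intersection. *)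
Lemma tends_on_not_Sigma3 : False.
Proof.
have /choice[f fP] : forall s : nat * ((nat -> nat) * nat), exists s' : (nat -> nat) * nat,
    [/\ (s.2.2 < s'.2)%N, D s.2.1 s.2.2 s.1 s'.1 &
      forall b, D s'.1 s'.2 s.1 b -> ~ forall k, O s.1 k b].
  move=> [i [a p]] /=; have [a' [p' H]] := avoid i a p i.
  by exists (a', p').
pose s := fix s k := if k is k'.+1 then f (k', s k') else ((fun=> 0%N), 0%N).
have step k := fP (k, s k).
have [||||c [cs cm]] := @fusion id (fun k => (s k).1) (fun k => (s k).2).
- by [].
- by move=> k; case: (step k).
- by move=> k; case: (step k) => _ [].
- by move=> k; case: (step k) => _ [].
have /HO[i Oi] : tends_on J c by move=> m; exists (s m).2 => j mj _; exact: cm mj.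
have [_ _ /(_ c)] := step i; apply=> //; split; first exact: cs i.+1.
by move=> j ij; exact: (@ltnW i (c j) (cm i.+1 j ij)).
Qed.

End NotSigma3.

Lemma increasing_locate (g : nat -> nat) : g 0%N = 0%N ->
  (forall k, (g k < g k.+1)%N) -> forall j, exists k, (g k <= j < g k.+1)%N.
Proof.
move=> g0 gS; elim=> [|j [k /andP[kj jk]]].
  by exists 0%N; rewrite g0 -[X in (X < _)%N]g0 gS.
have [jk1|kj1] := ltnP j.+1 (g k.+1); first by exists k; rewrite jk1 ltnW.
by exists k.+1; rewrite kj1 /= (leq_ltn_trans jk).
Qed.

Lemma increasing_locate_uniq (g : nat -> nat) k l j : (forall k, (g k < g k.+1)%N) ->
  (g k <= j < g k.+1)%N -> (g l <= j < g l.+1)%N -> k = l.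
Proof.
move=> gS.
have gm := increasing_homo gS.
move=> /andP[kj jk] /andP[lj jl]; case: (ltngtP k l) => // kl; have := gm _ _ kl; lia.
Qed.

(** [g k] is the position where the k-th path starts and [K j] the index of the path that contains
    the step from j to j.+1. *)
Lemma concatenate_paths {A : Type} (r : nat -> A -> A -> Prop) (d : nat -> A) :
  (forall k, exists n (w : nat -> A), [/\ (0 < n)%N, w 0%N = d k, w n = d k.+1 &
     forall i, (i < n)%N -> r k (w i) (w i.+1)]) ->
  exists (v : nat -> A) (g K : nat -> nat), [/\ (forall k, (g k < g k.+1)%N),
    (forall k, v (g k) = d k), (forall j, r (K j) (v j) (v j.+1)) &
    forall k j, (g k <= j)%N -> (k <= K j)%N].
Proof.
move=> /choice[n /choice[w H]].
pose g k := (\sum_(i < k) n i)%N.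
have gE k : g k.+1 = (g k + n k)%N by rewrite /g big_ord_recr.
have gS k : (g k < g k.+1)%N by rewrite gE -addn1 leq_add2l; case: (H k).
have g0 : g 0%N = 0%N by rewrite /g big_ord0.
have gm := increasing_homo gS.
have /choice[K KP] := increasing_locate g0 gS.
pose v j := w (K j) (j - g (K j))%N.
(* Both ends are included: the end of a path is the start of the next one. *)
have vE k j : (g k <= j <= g k.+1)%N -> v j = w k (j - g k)%N.
  move=> /andP[kj]; rewrite leq_eqVlt => /predU1P[jE|jk]; rewrite /v.
    have -> : K j = k.+1.
      by apply: (increasing_locate_uniq gS (KP j)); rewrite jE leqnn gS.
    rewrite jE subnn gE addKn.
    by case: (H k) => _ _ -> _; case: (H k.+1).
  have -> // : K j = k.
  by apply: (increasing_locate_uniq gS (KP j)); rewrite kj jk.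
exists v, g, K; split=> [//|k|j|k j kj].
- by rewrite (vE k) ?leqnn ?(ltnW (gS k))// subnn; case: (H k).
- have /andP[h1 h2] := KP j.
  have -> : v j = w (K j) (j - g (K j))%N by apply: vE; rewrite h1 ltnW.
  have -> : v j.+1 = w (K j) (j.+1 - g (K j))%N by apply: vE; rewrite h2 leqW.
  rewrite subSn//; case: (H (K j)) => _ _ _; apply.
  by rewrite ltn_subLR// -gE.
- rewrite leqNgt; apply/negP => /gm; have := KP j; lia.
Qed.

Lemma increasing_locate_from (g : nat -> nat) N q : (forall k, (g k < g k.+1)%N) ->
  (g N <= q)%N -> exists2 k, (N <= k)%N & (g k <= q < g k.+1)%N.
Proof.
move=> gS Nq; have gN l : (g N <= g (N + l))%N.
  by elim: l => [|l IH]; rewrite ?addn0// addnS (leq_trans IH)// ltnW.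
have [||l] := @increasing_locate (fun l => g (N + l) - g N)%N _ _ (q - g N).
- by rewrite addn0 subnn.
- by move=> l; have := gN l; have := gS (N + l)%N; rewrite addnS; lia.
by move=> H; exists (N + l)%N; [exact: leq_addr|have := gN l; rewrite -addnS; lia].
Qed.

Lemma infinitely_often_value (J : set nat) (a : nat -> nat) m :
  (forall N, exists j, [/\ (N <= j)%N, J j & (a j < m)%N]) ->
  exists c, forall N, exists j, [/\ (N <= j)%N, J j & a j = c].
Proof.
elim: m => [/(_ 0%N)[j []]//|m IH H].
have [//|nH] := pselect (exists c, forall N, exists j, [/\ (N <= j)%N, J j & a j = c]).
apply: IH => N.
have [N' N'P] : exists N', forall j, (N' <= j)%N -> J j -> a j <> m.
  apply: contrapT => nN; apply: nH; exists m => N1.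
  apply: contrapT => nj; apply: nN; exists N1 => j N1j Jj ajm.
  by apply: nj; exists j.
have [j [Nj Jj ajm]] := H (maxn N N'); move: Nj; rewrite geq_max => /andP[Nj N'j].
exists j; split=> //; have := N'P j N'j Jj; move: ajm; rewrite ltnS leq_eqVlt.
by move=> /predU1P[->|].
Qed.

(** * Tracing an invariant measure *)

Section Greedy.
Context {R : realType} {X : pmetricType R}.
Hypothesis cX : compact [set: X].

Lemma mean_gt0 (mu : measures X) (g : X -> R) : continuous g ->
  (forall x, 0 < g x) -> 0 < mean mu g.
Proof.
move=> cg g0.
have cg1 : continuous (fun x => (g x)^-1).
  by move=> x; apply: cvgV; [exact: lt0r_neq0|exact: cg].
have [M M0 gM] := compact_continuous_bounded cX cg1.
apply: (@lt_le_trans _ _ M^-1); first by rewrite invr_gt0.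
rewrite -(mean_cst mu M^-1); apply: mean_le => //; first exact: cst_continuous.
by move=> x; rewrite -[g x]invrK lef_pV2 ?posrE ?invr_gt0//;
  exact: le_trans (ler_norm _) (gM x).
Qed.

(* Each new point is chosen so that its vector has nonpositive inner product
   with the current sum; the squared norm of the sum then grows linearly. *)
Lemma greedy_points (mu : measures X) (k : nat) (h : nat -> X -> R) (B : R) :
  (forall i, continuous (h i)) -> (forall i, mean mu (h i) = 0) ->
  (forall i x, (i < k)%N -> `|h i x| <= B) ->
  exists z : nat -> X, forall c,
    \sum_(i < k) (\sum_(l < c) h i (z l)) ^+ 2 <= c%:R * (k%:R * B ^+ 2).
Proof.
move=> ch h0 hB.
(* The inner product has integral 0, so it cannot be positive everywhere. *)
have /choice[f fP] : forall s : nat -> R, exists x, \sum_(i < k) s i * h i x <= 0.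
  move=> s; apply: contrapT => nH.
  have cg i : continuous (fun x => s i * h i x).
    by move=> x; apply: cvgM; [exact: cvg_cst|exact: ch].
  have : 0 < mean mu (fun x => \sum_(i < k) s i * h i x).
    apply: mean_gt0; first exact: (continuous_sum (f := fun i x => s i * h i x)).
    by move=> x; rewrite ltNge; apply/negP => le0; apply: nH; exists x.
  rewrite (mean_sum cX mu k (f := fun i x => s i * h i x))//.
  by rewrite big1 ?ltxx// => i _; rewrite meanZ// h0 mulr0.
pose S := fix S c : nat -> R :=
  if c is c'.+1 then fun i => S c' i + h i (f (S c')) else fun=> 0.
exists (fun l => f (S l)) => c.
have SE i : \sum_(l < c) h i (f (S l)) = S c i.
  by elim: c => [|c IH]; rewrite ?big_ord0// big_ord_recr IH.
under eq_bigr do rewrite SE.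
elim: {SE} c => [|c IH]; first by rewrite big1 ?mul0r// => i _; rewrite expr0n.
have -> : \sum_(i < k) S c.+1 i ^+ 2 = \sum_(i < k) S c i ^+ 2 +
    (2 * (\sum_(i < k) S c i * h i (f (S c))) + \sum_(i < k) h i (f (S c)) ^+ 2).
  rewrite mulr_sumr -!big_split; apply: eq_bigr => i _ /=.
  by rewrite sqrrD -mulr_natl addrA.
rewrite -[c.+1%:R]natr1 [leRHS]mulrDl mul1r lerD// -[leRHS]add0r lerD//.
  by rewrite mulr_ge0_le0// fP.
rewrite -[X in X%:R * _](card_ord k) mulr_natl -sumr_const ler_sum// => i _.
have hi := hB i (f (S c)) (ltn_ord i).
rewrite -(@real_normK _ (h i (f (S c)))) ?num_real// lerXn2r// ?nnegrE//.
exact: le_trans (normr_ge0 _) hi.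
Qed.

(** The product of e * c and K / e is c * K, at most the square of their sum. The bound is linear in
    c with arbitrarily small slope, up to a constant. *)
Lemma norm_le_of_sqr (u c K e : R) : 0 < e -> 0 <= c -> 0 <= K ->
  u ^+ 2 <= c * K -> `|u| <= e * c + K / e.
Proof.
move=> e0 c0 K0 uK.
have h0 : 0 <= e * c + K / e by rewrite addr_ge0 ?mulr_ge0 ?invr_ge0// ltW.
rewrite -(@ler_pXn2r _ 2)// ?nnegrE// real_normK ?num_real// (le_trans uK)//.
have -> : c * K = (e * c) * (K / e) by field; exact: lt0r_neq0.
have : 0 <= e * c by rewrite mulr_ge0// ltW.
have : 0 <= K / e by rewrite divr_ge0// ltW.
by move: (e * c) (K / e) => a b; nra.
Qed.

End Greedy.

(** The end of block l when block 0 has length n, the others have length m, and [s j] is the gap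
    after block j. *)
Definition block_end (n m : nat) (s : nat -> nat) (l : nat) : nat :=
  (n + \sum_(j < l) (s j + m))%N.

Lemma block_end0 n m s : block_end n m s 0 = n.
Proof. by rewrite /block_end big_ord0 addn0. Qed.

Lemma block_endS n m s l : block_end n m s l.+1 = (block_end n m s l + s l + m)%N.
Proof. by rewrite /block_end big_ord_recr /= !addnA. Qed.

Lemma block_end_ge n m s l : (l * m + n <= block_end n m s l)%N.
Proof. by elim: l => [|l IH]; rewrite ?block_end0// block_endS mulSn; lia. Qed.

Lemma block_endE n m (s : nat -> nat) l :
  (\sum_(j < l.+1) (s j + if (j : nat) == 0 then n else m) =
   block_end n m s l + s l)%N.
Proof.
elim: l => [|l IH]; first by rewrite big_ord1 block_end0 addnC.
by rewrite big_ord_recr IH block_endS /=; lia.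
Qed.

(** q falls into the gap after block l or into block l.+1. The bound on l keeps it inside a finite
    specification. *)
Lemma block_end_locate n m s q : (0 < m)%N -> (n <= q)%N -> exists l,
  [/\ (n <= block_end n m s l <= q)%N, (l <= q - n)%N, (l * m <= q)%N
    & (q - block_end n m s l <= m + s l)%N].
Proof.
move=> m0 nq.
have [||l] := @increasing_locate (fun l => block_end n m s l - n)%N _ _ (q - n).
- by rewrite block_end0 subnn.
- by move=> l; rewrite block_endS; have := block_end_ge n m s l; lia.
rewrite block_endS; have := block_end_ge n m s l.
have : (l <= l * m)%N by rewrite leq_pmulr.
by move=> *; exists l; split; lia.
Qed.

Section Step.
Context {R : realType} {X : pmetricType R}.
Hypothesis cX : compact [set: X].
Variable T : X -> X.
Hypothesis cT : continuous T.

Lemma continuous_iter j : continuous (iter j T).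
Proof.
elim: j => [|j IH] x; first exact: cvg_id.
by apply: (@continuous_comp _ _ _ (iter j T) T); [exact: IH|exact: cT].
Qed.

Lemma continuous_comp_iter (f : X -> R) j : continuous f ->
  continuous (fun x => f (iter j T x)).
Proof.
move=> cf x; apply: (@continuous_comp _ _ _ (iter j T) f).
  exact: continuous_iter.
exact: cf.
Qed.

Definition birkhoff (f : X -> R) (q : nat) (y : X) : R :=
  \sum_(j < q) f (iter j T y).

Lemma continuous_birkhoff f q : continuous f -> continuous (birkhoff f q).
Proof.
move=> cf; apply: (continuous_sum (f := fun j x => f (iter j T x))) => j.
exact: continuous_comp_iter.
Qed.

Lemma mean_birkhoff mu f q : invariant_measures T mu -> continuous f ->
  mean mu (birkhoff f q) = q%:R * mean mu f.
Proof.
move=> imu cf; rewrite (mean_sum cX mu q (f := fun j x => f (iter j T x))); last first.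
  by move=> j; exact: continuous_comp_iter.
rewrite -[X in X%:R * _](card_ord q) mulr_natl -sumr_const; apply: eq_bigr => j _.
elim: (j : nat) => [//|l IH]; rewrite -IH.
rewrite -[RHS](mean_invariant cX cT imu); last exact: continuous_comp_iter.
by congr mean; apply/funext => x /=; rewrite -iterS iterSr.
Qed.

Lemma big_nat_shift (g : nat -> R) b m :
  \sum_(b <= u < b + m) g u = \sum_(j < m) g (j + b)%N.
Proof. by rewrite -{1}[b]add0n big_addn addKn big_mkord. Qed.

Lemma norm_sum_nat_le (g : nat -> R) a b C : (forall u, `|g u| <= C) ->
  `|\sum_(a <= u < b) g u| <= (b - a)%:R * C.
Proof.
move=> gC; rewrite (le_trans (ler_norm_sum _ _ _))//.
rewrite (le_trans (ler_sum _ (fun u _ => gC u)))// sumr_const_nat.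
by rewrite mulr_natl.
Qed.

(** A traced time costs at most e1; each of the at most d * m others costs at most 2 * C. *)
Lemma block_estimate (G : X -> R) (C e1 e d : R) m (L : {fset nat}) x y :
  (forall x, `|G x| <= C) -> 0 <= e1 ->
  (forall x y, mdist x y < e -> `|G x - G y| < e1) ->
  (L `<=` initial_segment m)%fset -> (1 - d) * m%:R <= #|` L|%:R ->
  bowen_ball T L x e y ->
  `|birkhoff G m y - birkhoff G m x| <= m%:R * (e1 + 2 * C * d).
Proof.
move=> GC e10 Ge Lm Ld Bxy.
have C0 : 0 <= C by exact: le_trans (normr_ge0 _) (GC x).
rewrite /birkhoff -sumrB (le_trans (ler_norm_sum _ _ _))//.
apply: (@le_trans _ _ (\sum_(j < m) (e1 + 2 * C * (1 - ((j : nat) \in L)%:R)))).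
  apply: ler_sum => j _; have [jL|jL] := boolP ((j : nat) \in L).
    by rewrite subrr mulr0 addr0 distrC ltW// Ge// Bxy.
  rewrite subr0 mulr1 (le_trans (ler_normB _ _))//.
  by have := GC (iter j T x); have := GC (iter j T y); lra.
rewrite big_split /= sumr_const card_ord -(mulr_natl e1) mulrDr lerD2l.
rewrite -mulr_sumr sumrB sumr_const card_ord mulrCA ler_wpM2l ?mulr_ge0//.
rewrite -natr_sum.
suff : (#|` L| <= \sum_(j < m) ((j : nat) \in L))%N by rewrite -(ler_nat R); lra.
rewrite -(big_mkord xpredT (fun j => nat_of_bool (j \in L))) -big_mkcond /=.
rewrite sum1_count /index_iota subn0 -size_filter.
apply: uniq_leq_size; first exact: fset_uniq.
move=> j jL; rewrite mem_filter [j \in L]jL /=.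
by have /fsubsetP/(_ j jL) := Lm; rewrite !inE.
Qed.

Hypothesis sapT : strong_approx_product_structure T.

(** A is chosen before y, n and n'. The specification consists of the past of y, as its first block,
    and many blocks of one fixed length m at greedy points. A gap is bounded by the length of the
    block after it, so a long past does not enlarge the gaps. *)
Lemma tracing_step (F : nat -> X -> R) (mu : measures X) (k : nat) (eta e : R) :
  (forall i, continuous (F i)) -> invariant_measures T mu -> 0 < eta -> 0 < e ->
  exists A : nat, forall y n n', (A <= n)%N -> (n <= n')%N ->
    exists y', (forall i, (i < n)%N -> mdist (iter i T y) (iter i T y') < e) /\
      forall q i, (n <= q <= n')%N -> (i < k)%N ->
        `|birkhoff (F i) q y' - birkhoff (F i) n y' - (q - n)%:R * mean mu (F i)|
          <= eta * q%:R.
Proof.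
move=> cF imu eta0 e0.
have [C C0 FC] : exists2 C, 0 < C & forall i x, (i < k)%N -> `|F i x| <= C.
  elim: k => [|k [C C0 IH]]; first by exists 1.
  have [M M0 FM] := compact_continuous_bounded cX (@cF k).
  exists (C + M); first by rewrite addr_gt0.
  move=> i x; rewrite ltnS leq_eqVlt => /predU1P[->|/IH Fi].
    by have := FM x; lra.
  by have := Fi x; lra.
have [d d0 Fd] : exists2 d, 0 < d & forall i x y, (i < k)%N -> mdist x y < d ->
    `|F i x - F i y| < eta / 8.
  elim: k {FC} => [|k [d d0 IH]]; first by exists 1.
  have e8 : 0 < eta / 8 by rewrite divr_gt0.
  have [r r0 Fr] := compact_uniformly_continuous cX (@cF k) e8.
  exists (Num.min d r); first by rewrite lt_min d0.
  move=> i x y ik; rewrite lt_min => /andP[xd xr].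
  by move: ik; rewrite ltnS leq_eqVlt => /predU1P[->|ik]; [exact: Fr|exact: IH].
(* Per unit of block length, the gap costs eta / 16, the untraced times eta / 16 and the traced ones
   eta / 8: in all eta / 4. *)
pose de := eta / (32 * C).
have de0 : 0 < de by rewrite divr_gt0// mulr_gt0.
have deC : 2 * C * de = eta / 16 by rewrite /de; field; exact: lt0r_neq0.
have ed0 : 0 < Num.min e d by rewrite lt_min e0.
have [N NP] := sapT ed0 de0 de0.
pose m := maxn N 1.
have m0 : (0 < m)%N by rewrite /m; lia.
have mR : 0 < m%:R :> R by rewrite ltr0n.
(* The deviation of one block average from the mean; its integral vanishes by invariance, as
   [greedy_points] requires. *)
pose h i x := birkhoff (F i) m x / m%:R - mean mu (F i).
have cb i : continuous (fun x => birkhoff (F i) m x / m%:R).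
  by move=> x; apply: cvgM; [exact: continuous_birkhoff|exact: cvg_cst].
have ch i : continuous (h i).
  by move=> x; apply: cvgB; [exact: cb|exact: cvg_cst].
have h0 i : mean mu (h i) = 0.
  rewrite /h meanB//; last exact: cst_continuous.
  under [X in mean _ X - _]eq_fun do rewrite mulrC.
  rewrite mean_cst meanZ//; last exact: continuous_birkhoff.
  by rewrite mean_birkhoff// mulKf ?subrr// lt0r_neq0.
have FC' i x : (i < k)%N -> `|F i x - mean mu (F i)| <= 2 * C.
  move=> ik; rewrite (le_trans (ler_normB _ _))// mulr_natl lerD ?FC//.
  by apply: mean_norm_le => // z; exact: FC.
have hB i x : (i < k)%N -> `|h i x| <= 2 * C.
  move=> ik; have -> : h i x = (\sum_(j < m) (F i (iter j T x) - mean mu (F i))) / m%:R.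
    rewrite sumrB sumr_const card_ord -[_ *+ m]mulr_natl /h mulrBl.
    by congr (_ - _); rewrite mulrAC divff ?mul1r// lt0r_neq0.
  rewrite normrM [X in _ * X]ger0_norm ?invr_ge0// ler_pdivrMr//.
  rewrite (le_trans (ler_norm_sum _ _ _))//.
  apply: (@le_trans _ _ (\sum_(j < m) 2 * C)).
    by apply: ler_sum => j _; exact: FC'.
  by rewrite sumr_const card_ord mulr_natr.
have [z zP] := greedy_points cX ch h0 hB.
pose kap : R := k%:R * (2 * C) ^+ 2.
have kap0 : 0 <= kap by rewrite mulr_ge0// exprn_ge0// mulr_ge0// ltW.
have hz c i : (i < k)%N -> `|\sum_(l < c) h i (z l)| <= eta / 4 * c%:R + kap / (eta / 4).
  move=> ik; apply: norm_le_of_sqr => //; first by rewrite divr_gt0.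
  apply: le_trans (zP c); rewrite (bigD1 (Ordinal ik))//= lerDl.
  by apply: sumr_ge0 => j _; exact: sqr_ge0.
(* The errors that do not grow with time: the last gap and incomplete block, and the constant left
   by [norm_le_of_sqr]. A makes them at most eta / 2 * n. *)
pose W := m%:R * (2 * C * (1 + de) + kap / (eta / 4)).
have W0 : 0 <= W.
  rewrite mulr_ge0// addr_ge0//; last by rewrite divr_ge0// divr_ge0// ltW.
  by rewrite mulr_ge0// ?mulr_ge0// ?addr_ge0// ltW.
pose A := maxn m (Num.bound (W / (eta / 2))).
have AW n : (A <= n)%N -> W <= eta / 2 * n%:R.
  move=> An; rewrite mulrC -ler_pdivrMr ?divr_gt0//.
  rewrite (le_trans (ltW (archi_boundP _)))//; last first.
    by rewrite ler_nat (leq_trans _ An)// leq_maxr.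
  by rewrite divr_ge0// divr_ge0// ltW.
exists A => y n n' An nn'.
have mn : (m <= n)%N by rewrite (leq_trans _ An)// leq_maxl.
pose len i := if i == 0%N then n else m.
(* As m > 0, n'.+1 blocks after the past suffice to reach time n'. *)
pose xi (j : 'I_n'.+2) : X * nat :=
  (if (j : nat) == 0%N then y else z (j : nat).-1, len j).
have lenm i : (m <= len i)%N by rewrite /len; case: ifP.
have [||y' [y0 [s sP]]] := NP _ xi.
- by move=> j; exact: leq_trans (lenm j).
- by move=> j; apply: leq_trans (lenm j); rewrite /m leq_maxl.
exists y'; split.
  move=> i ni; have : i \in initial_segment n by rewrite !inE /= mem_iota add0n.
  by move=> /y0; rewrite lt_min => /andP[].
move=> q i /andP[nq qn'] ik.
pose g u := F i (iter u T y') - mean mu (F i).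
have gC u : `|g u| <= 2 * C by exact: FC'.
have -> : birkhoff (F i) q y' - birkhoff (F i) n y' - (q - n)%:R * mean mu (F i)
    = \sum_(n <= u < q) g u.
  rewrite /birkhoff -!(big_mkord xpredT (fun j => F i (iter j T y'))).
  rewrite [X in X - _ - _ = _](big_cat_nat (leq0n n) nq)/= [X in X - _ = _]addrAC subrr add0r.
  by rewrite /g sumrB sumr_const_nat mulr_natl.
pose t := block_end n m s.
have tE l : t l.+1 = (t l + s l + m)%N by exact: block_endS.
have tS l : (t l <= t l.+1)%N by rewrite tE -addnA leq_addr.
have tn l : (n <= t l)%N by rewrite (leq_trans _ (block_end_ge _ _ _ _))// leq_addl.
have bE l : (l < n'.+1)%N -> (\sum_(j < n'.+2 | (j < l.+1)%N) (s j + (xi j).2))%N = (t l + s l)%N.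
  move=> ln; rewrite -(big_ord_widen _ (fun j => s j + len j)%N); last exact: ltnW.
  exact: block_endE.
have block l : (l < n'.+1)%N ->
    `|\sum_(t l <= u < t l.+1) g u - m%:R * h i (z l)| <= m%:R * (eta / 4).
  move=> ln; have ln1 : (l.+1 < n'.+2)%N by [].
  have /(_ isT)[sl [L [Lm Ld]]] := sP (Ordinal ln1).
  rewrite bE//= => Lball; rewrite /= /len /= in sl Lm Ld.
  rewrite (@big_cat_nat _ _ _ (t l + s l)%N) ?leq_addr ?tE ?leq_addr//=.
  have gap : `|\sum_(t l <= u < t l + s l) g u| <= m%:R * (eta / 16).
    rewrite (le_trans (norm_sum_nat_le _ _ gC))// addKn -deC.
    have -> : m%:R * (2 * C * de) = 2 * C * (de * m%:R) by ring.
    by rewrite mulrC ler_wpM2l// mulr_ge0// ltW.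
  have e80 : 0 <= eta / 8 by rewrite divr_ge0// ltW.
  have Lball' : bowen_ball T L (z l) d (iter (t l + s l) T y').
    by move=> j /Lball; rewrite lt_min => /andP[].
  have est := block_estimate (fun x => FC i x ik) e80 (fun x y => Fd i x y ik) Lm Ld Lball'.
  rewrite deC in est.
  have -> : m%:R * h i (z l) = birkhoff (F i) m (z l) - m%:R * mean mu (F i).
    by rewrite /h mulrBr mulrC mulfVK// lt0r_neq0.
  have -> : \sum_(t l + s l <= u < t l + s l + m) g u =
      birkhoff (F i) m (iter (t l + s l) T y') - m%:R * mean mu (F i).
    rewrite big_nat_shift /g sumrB sumr_const card_ord mulr_natl; congr (_ - _).
    by apply: eq_bigr => j _; rewrite iterD.
  move: (birkhoff _ _ (iter _ _ _)) (birkhoff _ _ (z l)) est => a b est.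
  move: (\sum_(_ <= _ < _) _) (m%:R * mean _ _) gap => c c' gap.
  have -> : c + (a - c') - (b - c') = c + (a - b) by ring.
  by rewrite (le_trans (ler_normD _ _))//; lra.
have path l : (l <= n'.+1)%N ->
    `|\sum_(n <= u < t l) g u - m%:R * \sum_(j < l) h i (z j)| <= (l * m)%:R * (eta / 4).
  elim: l => [_|l IH ln].
    by rewrite /t block_end0 !big_ord0 big_geq// mulr0 subr0 normr0 mul0n mul0r.
  rewrite (big_cat_nat (tn l) (tS l))/= big_ord_recr /= mulrDr opprD addrACA.
  rewrite (le_trans (ler_normD _ _))// mulSn addnC natrD mulrDl lerD ?block//.
  exact/IH/ltnW.
have [l [/andP[tnl tlq] lqn lmq qts]] := block_end_locate s m0 nq.
rewrite -/t in tnl tlq qts.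
have ln' : (l < n'.+1)%N by rewrite ltnS (leq_trans lqn)// (leq_trans (leq_subr _ _)).
have ln1 : (l.+1 < n'.+2)%N by [].
have /(_ isT)[sl _] := sP (Ordinal ln1); rewrite /= /len /= in sl.
rewrite (big_cat_nat tnl tlq)/=.
have h1 := path l (ltnW ln').
have h2 := hz l i ik.
have h3 : `|\sum_(t l <= u < q) g u| <= m%:R * (2 * C * (1 + de)).
  rewrite (le_trans (norm_sum_nat_le _ _ gC))//.
  have : (q - t l)%:R <= m%:R + (s l)%:R :> R by rewrite -natrD ler_nat.
  have : 0 <= 2 * C by rewrite mulr_ge0// ltW.
  by move: (2 * C) sl => c sl c0 qs; nra.
have h4 : (l * m)%:R <= q%:R :> R by rewrite ler_nat.
have h5 := AW n An.
have h6 : n%:R <= q%:R :> R by rewrite ler_nat.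
have h7 : `|m%:R * \sum_(j < l) h i (z j)| <= (l * m)%:R * (eta / 4) + m%:R * (kap / (eta / 4)).
  rewrite normrM ger0_norm// (le_trans (ler_wpM2l _ h2))// natrM mulrDr.
  by rewrite lerD2r le_eqVlt; apply/orP; left; apply/eqP; ring.
move: (\sum_(n <= u < t l) g u) (\sum_(t l <= u < q) g u) h1 h3 => a b h1 h3.
move: (m%:R * _) h1 h7 => c h1 h7.
rewrite (le_trans (ler_normD _ _))//.
have h10 := ler_normD (a - c) c; rewrite subrK in h10.
rewrite /W mulrDr in h5.
have h8 : (l * m)%:R * (eta / 2) <= q%:R * (eta / 2) by rewrite ler_wpM2r// divr_ge0// ltW.
have h9 : eta / 2 * n%:R <= q%:R * (eta / 2) by rewrite mulrC ler_wpM2r// divr_ge0// ltW.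
move: (kap / (eta / 4)) ((l * m)%:R) h1 h3 h5 h7 h8 h9 => x1 x2.
move: (m%:R * (2 * C * (1 + de))) (m%:R * x1) => x3 x4 *.
by lra.
Qed.

End Step.

(** * Following a timetable *)

Section Realization.
Context {R : realType} {X : pmetricType R}.
Hypothesis cX : compact [set: X].
Variable T : X -> X.
Hypothesis cT : continuous T.
Hypothesis sapT : strong_approx_product_structure T.

Lemma half_pow_lt (d : R) : 0 < d -> exists P, forall p, (P <= p)%N -> (2 ^+ p)^-1 < d.
Proof.
move=> d0; have [P Pd] := lt_inv_nat d0; exists P => p Pp.
rewrite (le_lt_trans _ Pd)// lef_pV2 ?posrE// ?exprn_gt0//.
by rewrite -natrX ler_nat (leq_trans _ (ltn_expl p _)).
Qed.

Lemma continuous_mdistr (a : X) : continuous (fun x => mdist a x).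
Proof.
apply/continuous_mdist => x e e0; exists e => // y xy.
rewrite ltr_norml; have := metric_triangle a x y.
have := metric_triangle a y x; rewrite (metric_sym y x); lra.
Qed.

Lemma cluster_le (u : nat -> X) (y : X) (g : X -> R) c N : continuous g ->
  cluster (u @ \oo) y -> (forall r, (N <= r)%N -> g (u r) <= c) -> g y <= c.
Proof.
move=> cg uy guc; rewrite leNgt; apply/negP => cgy.
have nb : nbhs y [set z | c < g z] by apply: (cvgr_gt _ (cg y)).
have fN : (u @ \oo) [set z | g z <= c] by exists N => // r; exact: guc.
by have [z [/= h1 h2]] := uy _ _ fN nb; move: h2; rewrite ltNge h1.
Qed.

(** [tt p] is the time when the p-th measure takes over; it must exceed the threshold of the p-th
    tracing step. *)
Definition timetable (A tt : nat -> nat) : Prop :=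
  forall p, (A p <= tt p)%N /\ (tt p <= tt p.+1)%N.

(** A depends on theta alone and y accepts every timetable above A. The last clause is continuity in
    the timetable. *)
Lemma realization (theta : nat -> measures X) :
  (forall p, invariant_measures T (theta p)) ->
  exists (A : nat -> nat) (y : (nat -> nat) -> X),
  [/\ forall p, (0 < A p)%N,
    forall tt, timetable A tt -> forall (f : X -> R) e, continuous f -> 0 < e ->
      exists P, forall p q, (P <= p)%N -> (tt p <= q <= tt p.+1)%N ->
        `|birkhoff T f q (y tt) - birkhoff T f (tt p) (y tt) -
          (q - tt p)%:R * mean (theta p) f| <= e * q%:R
  & forall tt e, timetable A tt -> 0 < e -> exists p, forall tt',
      timetable A tt' -> agree p tt tt' -> mdist (y tt) (y tt') < e].
Proof.
move=> itheta.
have [F [cF dF]] := continuous_separable cX.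
have /choice[A0 A0P] := fun p : nat =>
  @tracing_step _ _ cX T cT sapT F (theta p) p p.+1%:R^-1 (2 ^+ p)^-1 cF (itheta p)
    ltac:(by rewrite invr_gt0) ltac:(by rewrite invr_gt0 exprn_gt0).
pose A p := (A0 p).+1.
have /choice[g gP] : forall s : nat * X * (nat * nat), exists y',
    (A s.1.1 <= s.2.1)%N -> (s.2.1 <= s.2.2)%N ->
    (forall i, (i < s.2.1)%N -> mdist (iter i T s.1.2) (iter i T y') < (2 ^+ s.1.1)^-1) /\
      forall q i, (s.2.1 <= q <= s.2.2)%N -> (i < s.1.1)%N ->
        `|birkhoff T (F i) q y' - birkhoff T (F i) s.2.1 y' -
          (q - s.2.1)%:R * mean (theta s.1.1) (F i)| <= s.1.1.+1%:R^-1 * q%:R.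
  move=> [[p y] [n n']] /=; have [h|nh] := pselect ((A p <= n)%N /\ (n <= n')%N).
    by have [y' H] := A0P p y n n' (ltnW h.1) h.2; exists y'.
  by exists y => h1 h2; case: nh.
(* Because g is chosen once for all timetables, [Y tt p] depends only on the values of tt up to
   p. *)
pose Y tt := fix Y p := if p is p'.+1 then g (p', Y p', (tt p', tt p'.+1)) else point.
have /choice[y yP] : forall tt, exists y, cluster (Y tt @ \oo) y.
  move=> tt; have [|y [_ yP]] := @cX (Y tt @ \oo) _; last by exists y.
  exact: filterT.
have YS tt p : timetable A tt -> _ := fun h => gP (p, Y tt p, (tt p, tt p.+1)) (h p).1 (h p).2.
have ttm tt : timetable A tt -> {homo tt : i j / (i <= j)%N}.
  by move=> h; apply: homo_leq => [//|a b c|i]; [exact: leq_trans|exact: (h i).2].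
(* The partial sum of the geometric series of tracing errors 2^-p, ..., 2^-(r-1). *)
have Yr tt p r i : timetable A tt -> (i < tt p)%N -> (p <= r)%N ->
    mdist (iter i T (Y tt p)) (iter i T (Y tt r)) <= 2 * (2 ^+ p)^-1 - 2 * (2 ^+ r)^-1.
  move=> h ip; elim: r => [|r IH].
    by rewrite leqn0 => /eqP ->; rewrite mdistxx subrr.
  rewrite leq_eqVlt => /predU1P[->|]; first by rewrite mdistxx subrr.
  rewrite ltnS => pr.
  have ir : (i < tt r)%N by rewrite (leq_trans ip)// ttm.
  have := (YS tt r h).1 i ir; rewrite /= => h1.
  rewrite (le_trans (metric_triangle _ (iter i T (Y tt r)) _))//.
  have := IH pr; rewrite exprS invfM mulrA mulfV ?mul1r// => h2.
  by move: ((2 ^+ r)^-1) h1 h2 => x *; lra.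
have Yy tt p i : timetable A tt -> (i < tt p)%N ->
    mdist (iter i T (Y tt p)) (iter i T (y tt)) <= 2 * (2 ^+ p)^-1.
  move=> h ip.
  apply: (cluster_le (N := p) (g := fun z => mdist (iter i T (Y tt p)) (iter i T z)) _ (yP tt)).
    exact: (continuous_comp_iter cT (@continuous_mdistr (iter i T (Y tt p)))).
  move=> r pr; rewrite (le_trans (Yr tt p r i h ip pr))// gerBl.
  by rewrite mulr_ge0// invr_ge0 exprn_ge0.
exists A, y; split=> //.
- move=> tt h f e cf e0.
  have e8 : 0 < e / 8 by rewrite divr_gt0.
  have [i fi] := dF f _ cf e8.
  have [d d0 Fd] := compact_uniformly_continuous cX (@cF i) e8.
  have [P1 P1P] := half_pow_lt d0.
  have [P2 P2P] := lt_inv_nat e8.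
  exists (maxn i.+1 (maxn P1 P2)) => p q; rewrite !geq_max => /and3P[ip p1 p2] qtt.
  have [/andP[tq qt]] := qtt.
  (* The point that imitates theta p up to time tt p.+1; the later corrections add up to at most
     2^-p there. *)
  set n := tt p in tq *; set y' := Y tt p.+1.
  have dy j : (j < q)%N -> `|F i (iter j T y') - F i (iter j T (y tt))| <= e / 8.
    move=> jq; apply/ltW/Fd; rewrite (le_lt_trans (Yy tt p.+1 j h _))//.
      exact: leq_trans qt.
    by rewrite exprS invfM mulrA mulfV ?mul1r// P1P.
  have By r : (r <= q)%N -> `|birkhoff T f r (y tt) - birkhoff T (F i) r y'| <= r%:R * (e / 4).
    move=> rq; rewrite /birkhoff -sumrB (le_trans (ler_norm_sum _ _ _))//.
    apply: (@le_trans _ _ (\sum_(j < r) e / 4)).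
      apply: ler_sum => j _.
      have := dy j (leq_trans (ltn_ord j) rq); have := ltW (fi (iter j T (y tt))).
      rewrite !ler_norml => /andP[? ?] /andP[? ?]; apply/andP; split; lra.
    by rewrite sumr_const card_ord mulr_natl.
  have h1 := By q (leqnn q); have h2 := By n tq.
  have h3 := (YS tt p h).2 q i qtt ip; rewrite /= in h3.
  have h4 := mean_dist_le cX (theta p) cf (@cF i) (fun x => ltW (fi x)).
  have h5 : (q - n)%:R * `|mean (theta p) f - mean (theta p) (F i)| <= q%:R * (e / 8).
    by apply: ler_pM => //; rewrite ler_nat leq_subr.
  have h6 : n%:R * (e / 4) <= q%:R * (e / 4) by rewrite ler_wpM2r ?ler_nat// divr_ge0// ltW.
  have h7 : p.+1%:R^-1 * q%:R <= e / 8 * q%:R.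
    rewrite ler_wpM2r// ltW// (le_lt_trans _ P2P)// lef_pV2 ?posrE//.
    by rewrite ler_nat ltnS.
  have h8 : (q - n)%:R * `|mean (theta p) f - mean (theta p) (F i)| =
      `|(q - n)%:R * mean (theta p) f - (q - n)%:R * mean (theta p) (F i)|.
    by rewrite -mulrBr normrM [X in _ = X * _]ger0_norm.
  rewrite h8 in h5; move: h1 h2 h3 h5 h6 h7; rewrite -/y' -/n.
  move: (birkhoff T f q _) (birkhoff T f n _) ((q - n)%:R * mean (theta p) f).
  move: (birkhoff T (F i) q _) (birkhoff T (F i) n _) ((q - n)%:R * mean (theta p) (F i)).
  move: (p.+1%:R^-1 * q%:R) => w x1 x2 x3 x4 x5 x6.
  rewrite !ler_norml => /andP[? ?] /andP[? ?] /andP[? ?] /andP[? ?] ? ?.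
  by apply/andP; split; lra.
- move=> tt e h e0.
  have e4 : 0 < e / 4 by rewrite divr_gt0.
  have [P PP] := half_pow_lt e4.
  exists P.+1 => tt' h' tt'E.
  have YE p : (p <= P)%N -> Y tt p = Y tt' p.
    elim: p => // p IH pP /=; rewrite IH ?(ltnW pP)// !tt'E//.
    exact: leq_trans pP _.
  have h1 := Yy tt P 0%N h (leq_trans (ltn0Sn _) (h P).1).
  have h2 := Yy tt' P 0%N h' (leq_trans (ltn0Sn _) (h' P).1).
  rewrite /= -YE// in h2; rewrite /= in h1.
  rewrite (le_lt_trans (metric_triangle _ (Y tt P) _))// (metric_sym (y tt)).
  by have := PP P (leqnn P); lra.
Qed.

End Realization.

(** * Paths of measures *)

Section Mixture.
Context {R : realType} {X : pmetricType R}.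

Definition mixture (s t : {nonneg R}) (mu nu : probability (borel X) R) :
    set (borel X) -> \bar R := measure_add (mscale s mu) (mscale t nu).

HB.instance Definition _ s t mu nu := Measure.on (mixture s t mu nu).

Hypothesis cX : compact [set: X].

Lemma mixture_exists (mu nu : measures X) (t : R) : 0 <= t <= 1 ->
  exists rho : measures X, forall f : X -> R, continuous f ->
    mean rho f = (1 - t) * mean mu f + t * mean nu f.
Proof.
move=> /andP[t0 t1].
have s0 : 0 <= 1 - t by lra.
pose m := mixture (NngNum s0) (NngNum t0) mu nu.
have m1 : m setT = 1%E.
  rewrite /m /mixture measure_addE /mscale /=.
  have h1 : (mu : probability (borel X) R) setT = 1%E by exact: probability_setT.
  have h2 : (nu : probability (borel X) R) setT = 1%E by exact: probability_setT.
  transitivity ((1 - t)%:E * 1 + t%:E * 1 : \bar R)%E.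
    by congr (_ * _ + _ * _)%E; [exact: h1|exact: h2].
  by rewrite !mule1 -EFinD subrK.
pose P := Measure_isProbability.Build _ _ _ m m1.
pose rho : probability (borel X) R := HB.pack m P.
exists (rho : measures X).
have key (g : X -> R) : continuous g -> (forall x, 0 <= g x) ->
    mean (rho : measures X) g = (1 - t) * mean mu g + t * mean nu g.
  move=> cg g0.
  have mg : measurable_fun [set: borel X] (EFin \o (g : borel X -> R)).
    by apply/measurable_EFinP; exact: continuous_measurable.
  have fin (q : probability (borel X) R) : (\int[q]_x (g x)%:E)%E \is a fin_num.
    exact: (integrable_fin_num measurableT (continuous_integrable cX q cg)).
  rewrite /mean /Rintegral /rho /= /m /mixture.
  rewrite ge0_integral_measure_add//; last by move=> x _; rewrite lee_fin.
  rewrite !ge0_integral_mscale//; try by move=> x _; rewrite lee_fin.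
  have [fmu fnu] := (fin mu, fin nu).
  by rewrite fineD ?fineM//; apply: fin_numM.
move=> f cf; have [M M0 fM] := compact_continuous_bounded cX cf.
have cM : continuous (fun x : X => M + f x).
  by move=> y; apply: cvgD; [exact: cvg_cst|exact: cf].
have M0f x : 0 <= M + f x.
  by have := fM x; rewrite ler_norml => /andP[]; lra.
have := key _ cM M0f; rewrite !meanD ?mean_cst//; try exact: cst_continuous.
by move=> h; lra.
Qed.

(** Measures with equal integrals are topologically indistinguishable, so closed sets do not
    separate them. *)
Lemma mean_eq_closed (V : set (measures X)) mu nu : closed V -> V mu ->
  (forall f : X -> R, continuous f -> mean mu f = mean nu f) -> V nu.
Proof.
move=> clV Vmu munu; have [F [cF dF]] := continuous_separable cX.
apply: (closed_mean_close cX cF dF clV) => k; exists mu => // i _.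
by rewrite munu// subrr normr0 invr_gt0.
Qed.

(* Along the segment from a point of V to a point outside V, take the last
   parameter at which the segment meets V. *)
Lemma segment_exit (V : set (measures X)) nu : closed V -> V !=set0 -> ~ V nu ->
  exists2 mu, V mu & forall t rho, 0 < t <= 1 -> (forall f : X -> R, continuous f ->
    mean rho f = (1 - t) * mean mu f + t * mean nu f) -> ~ V rho.
Proof.
move=> clV [mu Vmu] nVnu; have [F [cF dF]] := continuous_separable cX.
pose on t rho := forall f : X -> R, continuous f ->
  mean rho f = (1 - t) * mean mu f + t * mean nu f.
pose S := [set t | 0 <= t <= 1 /\ exists2 rho, V rho & on t rho].
have S0 : S 0.
  split; first by rewrite lexx ler01.
  by exists mu => // f cf; rewrite subr0 mul1r mul0r addr0.
have hS : has_sup S by split; [exists 0|exists 1 => t [/andP[]]].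
pose t0 := sup S.
have t01 : 0 <= t0 <= 1.
  by rewrite sup_upper_bound//= sup_le_ub//; [exists 0|move=> t [/andP[]]].
have [m0 m0E] := mixture_exists mu nu t01.
have Vm0 : V m0.
  (* The supremum is attained: parameters of S close to t0 give measures of V close to m0, as the
     means are affine in t. *)
  apply: (closed_mean_close cX cF dF clV) => k.
  have [C C0 FC] : exists2 C, 0 < C & forall i, (i < k)%N ->
      `|mean nu (F i) - mean mu (F i)| <= C.
    elim: k => [|k [C C0 IH]]; first by exists 1.
    exists (C + `|mean nu (F k) - mean mu (F k)|); first by rewrite ltr_pwDl.
    move=> i; rewrite ltnS leq_eqVlt => /predU1P[->|/IH h].
      by rewrite lerDr ltW.
    by rewrite (le_trans h)// lerDl.
  have e0 : 0 < k.+1%:R^-1 / C :> R by rewrite divr_gt0 ?invr_gt0.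
  have [t St tt0] := sup_adherent e0 hS.
  have tle : t <= t0 by exact: sup_upper_bound.
  have [t01' [rho Vrho rhoE]] := St; exists rho => // i ik.
  rewrite rhoE// m0E//.
  have -> : forall a b, (1 - t) * a + t * b - ((1 - t0) * a + t0 * b) = (t - t0) * (b - a).
    by move=> a b; ring.
  rewrite normrM (@le_lt_trans _ _ (`|t - t0| * C))//.
    by rewrite ler_wpM2l// FC.
  rewrite -ltr_pdivlMr// distrC ger0_norm ?subr_ge0//.
  by rewrite ltrBlDr -ltrBlDl.
have t0lt1 : t0 < 1.
  rewrite lt_neqAle (andP t01).2 andbT; apply/eqP => t0E; apply: nVnu.
  apply: mean_eq_closed clV Vm0 _ => f cf; rewrite m0E// t0E.
  by rewrite subrr mul0r add0r mul1r.
exists m0 => // t rho /andP[tgt0 tle1] rhoE Vrho.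
have /andP[t00 _] := t01.
(* Parameter t on the segment from m0 to nu, expressed on the segment from mu to nu. *)
have : S (t0 + t * (1 - t0)).
  split.
    have s0 : 0 <= 1 - t0 by rewrite subr_ge0 ltW.
    have h1 : t * (1 - t0) <= 1 - t0 by rewrite ler_piMl.
    have h2 : 0 <= t * (1 - t0) by rewrite mulr_ge0// ltW.
    by apply/andP; split; lra.
  exists rho => // f cf; rewrite rhoE// m0E//; ring.
by move=> /(sup_upper_bound hS); rewrite -/t0 gerDl leNgt mulr_gt0// subr_gt0.
Qed.

End Mixture.

Section Chains.
Context {R : realType} {X : pmetricType R}.
Hypothesis cX : compact [set: X].
Variable F : nat -> X -> R.
Hypothesis cF : forall i, continuous (F i).
Hypothesis dF : forall (f : X -> R) (e : R), continuous f -> 0 < e ->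
  exists i, forall x, `|f x - F i x| < e.
Variable V : set (measures X).

Definition chain_step k (a b : measures X) := [/\ V a, V b & mean_close F k a b].

(** The points of V reachable from u by k-close steps form a nonempty, relatively open and closed
    subset. *)
Lemma connected_chain k u w : connected V -> V u -> V w ->
  exists n (p : nat -> measures X), [/\ (0 < n)%N, p 0%N = u, p n = w &
    forall i, (i < n)%N -> chain_step k (p i) (p i.+1)].
Proof.
move=> conV Vu.
pose B := [set w | V w /\ exists n (p : nat -> measures X),
  [/\ (0 < n)%N, p 0%N = u, p n = w &
    forall i, (i < n)%N -> chain_step k (p i) (p i.+1)]].
have ext a b : B a -> V b -> mean_close F k a b -> B b.
  move=> [Va [n [p [n0 pu pa pS]]]] Vb ab; split=> //.
  exists n.+1, (fun i => if (i <= n)%N then p i else b).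
  split=> //; first by rewrite ltnn.
  move=> i; rewrite ltnS leq_eqVlt => /predU1P[->|lin].
    by rewrite eqxx ltnn pa.
  by rewrite lin orbT; exact: pS.
have oc (W : set (measures X)) : open (\bigcup_(a in W) [set b | mean_close F k b a]).
  by apply: bigcup_open => a _; exact: open_mean_close.
have BV : B = V.
  apply: conV.
  - exists u; split=> //; exists 1%N, (fun=> u); split=> // i _.
    by split=> //; exact: mean_close_refl.
  - exists (\bigcup_(a in B) [set b | mean_close F k b a]); first exact: oc.
    apply/seteqP; split=> [b Bb|b [Vb [a Ba ab]]].
      by split; [exact: Bb.1|exists b => //; exact: mean_close_refl].
    by apply: (ext a) => //; exact: mean_close_sym.
  - exists (~` \bigcup_(a in V `\` B) [set b | mean_close F k b a]).
      exact/open_closedC/oc.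
    apply/seteqP; split=> [b Bb|b [Vb nb]].
      split; first exact: Bb.1.
      by move=> [a [Va nBa] /= ba]; apply: nBa; apply: ext Bb Va ba.
    apply: contrapT => nBb; apply: nb; exists b => //; exact: mean_close_refl.
by move=> Vw; have : B w by [rewrite BV]; case.
Qed.

(** Countably many conditions say that the first k means are near given rationals; one point of V is
    chosen for each condition that V can satisfy, and each point is listed infinitely often. *)
Lemma dense_sequence mu0 : V mu0 -> exists d : nat -> measures X,
  [/\ forall j, V (d j), forall N, exists2 j, (N <= j)%N & d j = mu0 &
    forall v k N, V v -> exists2 j, (N <= j)%N & mean_close F k (d j) v].
Proof.
move=> Vmu0.
pose P (c : nat * seq rat) v := V v /\ forall i, (i < c.1)%N ->
  `|mean v (F i) - ratr (nth 0 c.2 i)| < (2 * c.1 + 1).+1%:R^-1.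
have /choice[e eP] : forall c, exists v, V v /\ ((exists v', P c v') -> P c v).
  move=> c; have [[v Pv]|nP] := pselect (exists v', P c v').
    by exists v; split=> //; case: Pv.
  by exists mu0; split.
pose dc (a : nat) := if a is a'.+1 then
  (if choice.unpickle a' is Some c then e c else mu0) else mu0.
(* [logn 2] takes every value infinitely often. *)
have log2 a N : exists2 j, (N <= j)%N & logn 2 j = a.
  exists (2 ^ a * (2 * N).+1)%N.
    by rewrite (leq_trans (_ : N <= (2 * N).+1))%N ?leq_pmull ?expn_gt0//; lia.
  rewrite lognM ?expn_gt0// pfactorK// (_ : logn 2 (2 * N).+1 = 0%N) ?addn0//.
  by apply/eqP; rewrite -leqn0 leqNgt logn_gt0 mem_primes /= dvdn2 /= oddM.
exists (fun j => dc (logn 2 j)); split.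
- move=> j; rewrite /dc; case: logn => // a; case: choice.unpickle => // c.
  by case: (eP c).
- by move=> N; have [j Nj jE] := log2 0%N N; exists j => //; rewrite jE.
- move=> v k N Vv.
  have /choice[q qP] : forall i, exists q : rat,
      `|mean v (F i) - ratr q| < (2 * k + 1).+1%:R^-1.
    move=> i; have r0 : 0 < (2 * k + 1).+1%:R^-1 :> R by rewrite invr_gt0.
    move: (_^-1) r0 => r r0; move: (mean v (F i)) => x.
    have lt_q : x - r < x + r by lra.
    have [q] := rat_in_itvoo lt_q; rewrite in_itv /= => /andP[h1 h2].
    by exists q; rewrite distrC ltr_norml; apply/andP; split; lra.
  pose c := (k, mkseq q k).
  have cE (w : measures X) i : (i < k)%N -> `|mean w (F i) - ratr (nth 0 c.2 i)| =
      `|mean w (F i) - ratr (q i)| by move=> ik; rewrite /= nth_mkseq.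
  have cv : P c v by split=> // i ik; rewrite cE.
  have [j Nj jE] := log2 (choice.pickle c).+1 N; exists j => //.
  rewrite jE /dc choice.pickleK => i ik.
  have [_ /(_ (ex_intro _ v cv))[_ ecP]] := eP c.
  have := ecP i ik; rewrite cE// => h1; have := qP i => h2.
  rewrite half_radius (le_lt_trans (ler_distD (ratr (q i)) _ _))// ltrD//.
  by rewrite distrC.
Qed.

End Chains.

(** * The reduction *)

Lemma eventually_forall_lt (P : nat -> nat -> Prop) k :
  (forall i, exists N, forall j, (N <= j)%N -> P i j) ->
  exists N, forall i j, (i < k)%N -> (N <= j)%N -> P i j.
Proof.
move=> H; elim: k => [|k [N NP]]; first by exists 0%N.
have [M MP] := H k; exists (maxn N M) => i j; rewrite geq_max ltnS leq_eqVlt.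
by move=> /predU1P[->|ik] /andP[Nj Mj]; [exact: MP|exact: NP].
Qed.

Section Wandering.
Context {R : realType} {X : pmetricType R}.
Hypothesis cX : compact [set: X].
Variable F : nat -> X -> R.
Hypothesis cF : forall i, continuous (F i).
Hypothesis dF : forall (f : X -> R) (e : R), continuous f -> 0 < e ->
  exists i, forall x, `|f x - F i x| < e.
Variable V : set (measures X).

(** Consecutive terms of a dense sequence that returns to mu0 are joined inside V, the k-th pair by
    k-close steps. *)
Lemma wandering_sequence mu0 : connected V -> V mu0 ->
  exists v : nat -> measures X, [/\ forall j, V (v j),
    forall k, exists N, forall j, (N <= j)%N -> mean_close F k (v j) (v j.+1),
    forall N, exists2 j, (N <= j)%N & v j = mu0 &
    forall w k N, V w -> exists2 j, (N <= j)%N & mean_close F k (v j) w].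
Proof.
move=> conV Vmu0.
have [d [Vd d0 dd]] := dense_sequence F Vmu0.
have paths k : exists n (p : nat -> measures X), [/\ (0 < n)%N, p 0%N = d k, p n = d k.+1 &
    forall i, (i < n)%N -> chain_step F V k (p i) (p i.+1)].
  exact: connected_chain.
have [v [g [K [gS vg vK gK]]]] := concatenate_paths paths.
have g_ge k : (k <= g k)%N by elim: k => // k /leq_ltn_trans; apply.
exists v; split.
- by move=> j; case: (vK j).
- move=> k; exists (g k) => j /gK kj; case: (vK j) => _ _.
  exact: mean_close_le.
- move=> N; have [j Nj jE] := d0 N; exists (g j); last by rewrite vg.
  exact: leq_trans (g_ge j).
- move=> w k N Vw; have [j Nj jE] := dd w k N Vw; exists (g j); last by rewrite vg.
  exact: leq_trans (g_ge j).
Qed.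

(** The predecessor appears because [empirical_measure T x n] averages n + 1 points. *)
Lemma mean_close_empirical (T : X -> X) k q x rho (e : R) : (0 < q)%N ->
  (forall i, (i < k)%N ->
    `|birkhoff T (F i) q x - q%:R * mean rho (F i)| <= e * q%:R) ->
  e < k.+1%:R^-1 -> mean_close F k (empirical_measure T x q.-1) rho.
Proof.
move=> q0 H ek i ik; rewrite mean_empirical// (prednK q0).
rewrite (le_lt_trans _ ek)// -(ler_pM2r (_ : 0 < q%:R)) ?ltr0n//.
apply: le_trans (H i ik).
rewrite -[X in _ * X](ger0_norm (ler0n R q)) -normrM mulrBl.
by rewrite divfK ?pnatr_eq0 -?lt0n// [mean _ _ * _]mulrC.
Qed.

End Wandering.

Section LowerBound.
Context {R : realType} {X : pmetricType R}.
Hypothesis cX : compact [set: X].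
Variable T : X -> X.
Hypothesis cT : continuous T.
Hypothesis sapT : strong_approx_product_structure T.
Variable V : set (measures X).
Hypothesis VT : V `<=` invariant_measures T.
Hypothesis V0 : V !=set0.
Hypothesis clV : closed V.
Hypothesis conV : connected V.

(** * The switching times *)

Section Schedule.
Variables (J : set nat) (A : nat -> nat).
Hypothesis A0 : forall p, (0 < A p)%N.
Variable a : nat -> nat.

(* Stage j imitates the j-th measure of V from time [cycle_start j] to time
   [long_end (cycle_start j) j] and the measure outside V from then on until
   [cycle_start j.+1]; [schedule] lists all these times in increasing order. *)
Definition long_end (u j : nat) : nat :=
  (j.+2 * (u + A (2 * j).+1 + A (2 * j).+2))%N.

Fixpoint cycle_start (j : nat) : nat :=
  if j is i.+1 then
    let w := long_end (cycle_start i) i in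
    (w + if i \in J then w %/ (a i).+1 else 0)%N
  else A 0.

Definition schedule (p : nat) : nat :=
  if odd p then long_end (cycle_start p./2) p./2 else cycle_start p./2.

Lemma schedule_even j : schedule (2 * j) = cycle_start j.
Proof. by rewrite /schedule mul2n odd_double doubleK. Qed.

Lemma schedule_odd j : schedule (2 * j).+1 = long_end (cycle_start j) j.
Proof. by rewrite /schedule mul2n /= odd_double /= uphalf_double. Qed.

(** The factor makes the past a vanishing fraction of the long phase; the two values of A delay both
    following switches enough for a timetable. *)
Lemma long_end_ge u j : [/\ (j.+2 * u <= long_end u j)%N,
  (A (2 * j).+1 <= long_end u j)%N & (A (2 * j).+2 <= long_end u j)%N].
Proof. by rewrite /long_end; split; nia. Qed.

Lemma schedule_timetable : timetable A schedule.
Proof.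
move=> p.
have start_ge j : (A (2 * j) <= cycle_start j)%N.
  case: j => [|j]; rewrite ?muln0//.
  have [_ _ h] := long_end_ge (cycle_start j) j.
  by rewrite mulnS add2n (leq_trans h)//= leq_addr.
rewrite -(odd_double_half p) -mul2n; case: (odd p); rewrite ?add1n ?add0n.
  rewrite -[(2 * _).+2]add2n -mulnS schedule_odd schedule_even /=.
  by have [_ -> _] := long_end_ge (cycle_start p./2) p./2; rewrite leq_addr.
rewrite schedule_odd schedule_even start_ge.
have [h _ _] := long_end_ge (cycle_start p./2) p./2.
by rewrite (leq_trans _ h)// leq_pmull.
Qed.

Lemma cycle_start_gt0 j : (0 < cycle_start j)%N.
Proof.
by have [h _] := schedule_timetable (2 * j); rewrite -schedule_even (leq_trans _ h).
Qed.

Lemma cycle_start_lt j : (cycle_start j < cycle_start j.+1)%N.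
Proof.
have [h _ _] := long_end_ge (cycle_start j) j.
rewrite /= (leq_trans _ (leq_addr _ _))// (leq_trans _ h)//.
by have := cycle_start_gt0 j; nia.
Qed.

Lemma cycle_start_ge j : (j <= cycle_start j)%N.
Proof. by elim: j => // j /leq_ltn_trans; apply; exact: cycle_start_lt. Qed.

End Schedule.

(** The start of cycle j reads only the values of a before j; this gives continuity of the
    reduction. *)
Lemma schedule_agree J A p a b : agree p a b -> agree p (schedule J A a) (schedule J A b).
Proof.
move=> ab.
have start j : (j <= p)%N -> cycle_start J A a j = cycle_start J A b j.
  by elim: j => [//|j IH] jp; rewrite /= (IH (ltnW jp)) (ab j jp).
move=> i ip; rewrite /schedule start// (leq_trans _ (ltnW ip))//.
by rewrite -[leqRHS]odd_double_half -addnn addnA leq_addl.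
Qed.

(** * Averages along an orbit that keeps the timetable *)

Section Orbit.
Variables (J : set nat) (A : nat -> nat) (a : nat -> nat) (x : X).
Hypothesis A0 : forall p, (0 < A p)%N.
Variables (v : nat -> measures X) (nu : measures X).
Let tt := schedule J A a.
Let theta p := if odd p then nu else v p./2.
Hypothesis xP : forall (f : X -> R) e, continuous f -> 0 < e ->
  exists P, forall p q, (P <= p)%N -> (tt p <= q <= tt p.+1)%N ->
    `|birkhoff T f q x - birkhoff T f (tt p) x - (q - tt p)%:R * mean (theta p) f|
      <= e * q%:R.
Let u := cycle_start J A a.
Let w j := long_end A (u j) j.

Let uS j : u j.+1 = (w j + if j \in J then w j %/ (a j).+1 else 0)%N.
Proof. by []. Qed.

Let theta_even j : theta (2 * j) = v j.
Proof. by rewrite /theta mul2n odd_double doubleK. Qed.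

Let theta_odd j : theta (2 * j).+1 = nu.
Proof. by rewrite /theta mul2n /= odd_double. Qed.

(** The times before u j are at most a fraction 1/(j+2) of w j, so the average at w j forgets the
    earlier phases. *)
Lemma long_phase (f : X -> R) (e : R) : continuous f -> 0 < e ->
  exists N, forall j, (N <= j)%N ->
    `|birkhoff T f (w j) x - (w j)%:R * mean (v j) f| <= e * (w j)%:R.
Proof.
move=> cf e0; have [C C0 fC] := compact_continuous_bounded cX cf.
have e2 : 0 < e / 2 by rewrite divr_gt0.
have [P PP] := xP cf e2.
pose N := Num.bound (4 * C / e).
exists (maxn P N) => j; rewrite geq_max => /andP[Pj Nj].
have [ju _ _] := long_end_ge A (u j) j.
have uw : (u j <= w j)%N by rewrite (leq_trans _ ju)// leq_pmull.
have := PP (2 * j)%N (w j) (leq_trans Pj (leq_pmull _ _)) .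
rewrite /tt schedule_even schedule_odd theta_even -/u -/(w j) uw leqnn => /(_ isT isT).
rewrite natrB// => h1.
have h2 : `|birkhoff T f (u j) x| <= (u j)%:R * C.
  rewrite /birkhoff (le_trans (ler_norm_sum _ _ _))//.
  apply: (@le_trans _ _ (\sum_(i < u j) C)); first by apply: ler_sum => i _; exact: fC.
  by rewrite sumr_const card_ord mulr_natl.
have h3 : `|(u j)%:R * mean (v j) f| <= (u j)%:R * C.
  by rewrite normrM ger0_norm// ler_wpM2l// mean_norm_le.
have h4 : 2 * C * (u j)%:R <= e / 2 * (w j)%:R.
  have je : 4 * C <= e * j%:R.
    rewrite [leRHS]mulrC -ler_pdivrMr// (le_trans (ltW (archi_boundP _)))//.
      by rewrite divr_ge0 ?mulr_ge0// ltW.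
    by rewrite ler_nat.
  have : j%:R * (u j)%:R <= (w j)%:R :> R.
    by rewrite -natrM ler_nat (leq_trans _ ju)// leq_mul2r (leq_trans (leqnSn _) (leqnSn _)) orbT.
  have : 0 <= (u j)%:R :> R by [].
  move: (u j)%:R (w j)%:R j%:R je => U W I je U0 IU.
  have : 4 * C * U <= e * I * U by rewrite ler_wpM2r.
  have : e * (I * U) <= e * W by rewrite ler_wpM2l// ltW.
  by rewrite mulrA; lra.
move: h1 h2 h3 h4; move: (birkhoff T f (w j) x) (birkhoff T f (u j) x) => s1 s2.
have -> : ((w j)%:R - (u j)%:R) * mean (v j) f =
  (w j)%:R * mean (v j) f - (u j)%:R * mean (v j) f by ring.
move: ((w j)%:R * mean (v j) f) ((u j)%:R * mean (v j) f) => m1 m2.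
move: ((w j)%:R) ((u j)%:R) => W U.
rewrite !ler_norml => /andP[? ?] /andP[? ?] /andP[? ?] ?.
by apply/andP; split; lra.
Qed.

Lemma short_phase (f : X -> R) (e : R) : continuous f -> 0 < e ->
  exists N, forall j q, (N <= j)%N -> (w j <= q <= u j.+1)%N ->
    `|birkhoff T f q x - (w j)%:R * mean (v j) f - (q - w j)%:R * mean nu f|
      <= e * q%:R.
Proof.
move=> cf e0; have e2 : 0 < e / 2 by rewrite divr_gt0.
have [P PP] := xP cf e2; have [N NP] := long_phase cf e2.
exists (maxn P N) => j q; rewrite geq_max => /andP[Pj Nj] /andP[wq qu].
have h1 := NP j Nj.
have := PP (2 * j).+1 q (leq_trans (leq_trans Pj (leq_pmull _ _)) (leqnSn _)).
rewrite -[(2 * j).+2]add2n -mulnS /tt schedule_even schedule_odd theta_odd -/u -/(w j).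
rewrite wq qu => /(_ isT isT) h2.
have h3 : e / 2 * (w j)%:R <= e / 2 * q%:R by rewrite ler_wpM2l ?ler_nat// ltW.
move: h1 h2 h3; move: (birkhoff T f (w j) x) (birkhoff T f q x) => s1 s2.
move: ((w j)%:R * mean (v j) f) (_ * mean nu f) => m1 m2.
rewrite !ler_norml => /andP[? ?] /andP[? ?] ?.
by apply/andP; split; lra.
Qed.

Lemma next_phase (f : X -> R) (e : R) : continuous f -> 0 < e ->
  exists N, forall j q, (N <= j)%N -> (u j.+1 <= q <= w j.+1)%N ->
    `|birkhoff T f q x - (w j)%:R * mean (v j) f - (u j.+1 - w j)%:R * mean nu f
      - (q - u j.+1)%:R * mean (v j.+1) f| <= e * q%:R.
Proof.
move=> cf e0; have e2 : 0 < e / 2 by rewrite divr_gt0.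
have [P PP] := xP cf e2; have [N NP] := short_phase cf e2.
exists (maxn P N) => j q; rewrite geq_max => /andP[Pj Nj] /andP[uq qw].
have wu : (w j <= u j.+1)%N by rewrite uS leq_addr.
have h1 := NP j (u j.+1) Nj ltac:(by rewrite wu leqnn).
have := PP (2 * j.+1)%N q (leq_trans Pj (leq_trans (leqnSn _) (leq_pmull _ _))).
rewrite /tt schedule_even schedule_odd theta_even -/u -/(w j.+1) uq qw.
move=> /(_ isT isT) h2.
have h3 : e / 2 * (u j.+1)%:R <= e / 2 * q%:R by rewrite ler_wpM2l ?ler_nat// ltW.
move: h1 h2 h3; move: (birkhoff T f (u j.+1) x) (birkhoff T f q x) => s1 s2.
move: ((w j)%:R * mean (v j) f) (_ * mean nu f) (_ * mean (v j.+1) f) => m1 m2 m3.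
rewrite !ler_norml => /andP[? ?] /andP[? ?] ?.
by apply/andP; split; lra.
Qed.

Lemma perturbation_small (d : R) : tends_on J a -> 0 < d ->
  exists N, forall j, (N <= j)%N -> (u j.+1 - w j)%:R <= d * (w j)%:R.
Proof.
move=> aJ d0; have [N NP] := aJ (Num.bound d^-1); exists N => j Nj.
rewrite uS addKn; case: ifPn => [/set_mem Jj|_]; last by rewrite mulr_ge0// ltW.
rewrite -ler_pdivrMl//.
apply: (@le_trans _ _ (((a j).+1 * (w j %/ (a j).+1))%:R)); last first.
  by rewrite ler_nat mulnC leq_trunc_div.
rewrite natrM ler_wpM2r// (le_trans (ltW (archi_boundP _)))//.
  by rewrite invr_ge0 ltW.
by rewrite ler_nat leqW// NP.
Qed.

Hypothesis v_slow : forall (f : X -> R) e, continuous f -> 0 < e ->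
  exists N, forall j, (N <= j)%N -> `|mean (v j) f - mean (v j.+1) f| < e.

(** During cycle j the average is made of the preceding measure of V, which is close to v j, of v j
    itself, and of nu for a fraction of time that vanishes as a tends to infinity on J. *)
Lemma shadowing (f : X -> R) (e : R) : tends_on J a -> continuous f -> 0 < e ->
  exists N, forall j, (N <= j)%N -> forall q, (u j <= q <= u j.+1)%N ->
    `|birkhoff T f q x - q%:R * mean (v j) f| <= e * q%:R.
Proof.
move=> aJ cf e0; have [C C0 fC] := compact_continuous_bounded cX cf.
have e4 : 0 < e / 4 by rewrite divr_gt0.
have d0 : 0 < e / (8 * C) by rewrite divr_gt0// mulr_gt0.
have dC : e / (8 * C) * (2 * C) = e / 4 by field; exact: lt0r_neq0.
have [N1 N1P] := short_phase cf e4; have [N2 N2P] := next_phase cf e4.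
have [N3 N3P] := perturbation_small aJ d0; have [N4 N4P] := v_slow cf e4.
have mC mu nu' : `|mean mu f - mean nu' f| <= 2 * C.
  rewrite (le_trans (ler_normB _ _))// mulr_natl lerD//.
    exact: mean_norm_le.
  exact: mean_norm_le.
have small j n : (N3 <= j)%N -> (n <= u j.+1 - w j)%N -> forall mu nu',
    `|n%:R * (mean mu f - mean nu' f)| <= e / 4 * (w j)%:R.
  move=> Nj nu_ mu nu'; rewrite normrM ger0_norm//.
  rewrite (@le_trans _ _ (e / (8 * C) * (w j)%:R * (2 * C)))//.
    apply: ler_pM => //; apply: le_trans (N3P j Nj).
    by rewrite ler_nat.
  by rewrite mulrAC dC.
(* The successor guarantees that a preceding cycle i exists. *)
exists (maxn (maxn N1 N2) (maxn N3 N4)).+1 => -[//|i].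
rewrite ltnS !geq_max => /andP[/andP[i1 i2] /andP[i3 i4]] q /andP[uq qu].
have [qw|wq] := leqP q (w i.+1).
  have h1 := N2P i q i2 ltac:(by rewrite uq qw).
  have h2 := small i (u i.+1 - w i)%N i3 (leqnn _) nu (v i.+1).
  have h3 := N4P i i4.
  have wu : (w i <= u i.+1)%N by rewrite uS leq_addr.
  have h4 : (w i)%:R <= q%:R :> R by rewrite ler_nat (leq_trans wu).
  have h5 : `|(w i)%:R * (mean (v i) f - mean (v i.+1) f)| <= (w i)%:R * (e / 4).
    by rewrite normrM ger0_norm// ler_wpM2l// ltW.
  have h6 : e / 4 * (w i)%:R <= e / 4 * q%:R by rewrite ler_wpM2l// ltW.
  move: h1 h2 h5; rewrite !natrB//; move: (mean nu f) (mean (v i) f) (mean (v i.+1) f).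
  move=> b c d; move: (birkhoff T f q x) => S.
  have eQ : 0 <= e * q%:R by rewrite mulr_ge0// ltW.
  move: (w i)%:R (u i.+1)%:R q%:R h4 h6 eQ => W U Q h4 h6 eQ h1 h2 h5.
  have -> : S - Q * d = (S - W * c - (U - W) * b - (Q - U) * d) + W * (c - d) + (U - W) * (b - d).
    by ring.
  rewrite (le_trans (ler_normD _ _))//.
  by have := ler_normD (S - W * c - (U - W) * b - (Q - U) * d) (W * (c - d)); lra.
have Ni1 : (N1 <= i.+1)%N by exact: leqW.
have Ni3 : (N3 <= i.+1)%N by exact: leqW.
have wq' := ltnW wq.
have h1 := N1P i.+1 q Ni1 ltac:(by rewrite wq' qu).
have h2 := small i.+1 (q - w i.+1)%N Ni3 (leq_sub2r _ qu) nu (v i.+1).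
have h6 : e / 4 * (w i.+1)%:R <= e / 4 * q%:R by rewrite ler_wpM2l ?ler_nat// ltW.
move: h1 h2; rewrite !natrB//; move: (mean nu f) (mean (v i.+1) f) => b d.
move: (birkhoff T f q x) => S.
have eQ : 0 <= e * q%:R by rewrite mulr_ge0// ltW.
move: (w i.+1)%:R q%:R h6 eQ => W Q h6 eQ h1 h2.
have -> : S - Q * d = (S - W * d - (Q - W) * b) + (Q - W) * (b - d) by ring.
by rewrite (le_trans (ler_normD _ _))//; lra.
Qed.

(** Adding a fraction 1/(c+1) of the elapsed time spent near nu gives nu the share 1/(c+2) of the
    total. *)
Lemma cycle_perturbed (f : X -> R) (e : R) c mu0 : continuous f -> 0 < e ->
  exists N, forall j, (N <= j)%N -> J j -> v j = mu0 -> a j = c ->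
    `|birkhoff T f (u j.+1) x - (u j.+1)%:R *
      ((1 - c.+2%:R^-1) * mean mu0 f + c.+2%:R^-1 * mean nu f)| <= e * (u j.+1)%:R.
Proof.
move=> cf e0; have [C C0 fC] := compact_continuous_bounded cX cf.
have e2 : 0 < e / 2 by rewrite divr_gt0.
have [N1 N1P] := short_phase cf e2.
pose N2 := Num.bound (2 * C / (e / 2)).
exists (maxn N1 N2) => j; rewrite geq_max => /andP[j1 j2] Jj vj aj.
have wu : (w j <= u j.+1)%N by rewrite uS leq_addr.
have := N1P j (u j.+1) j1 ltac:(by rewrite wu leqnn).
rewrite vj natrB// => h1.
have rE : u j.+1 = (w j + w j %/ c.+1)%N by rewrite uS mem_set// aj.
have := divn_eq (w j) c.+1; have := ltn_pmod (w j) (ltn0Sn c).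
move=> modlt divE.
have modR : (w j %% c.+1)%:R <= c.+2%:R :> R by rewrite ler_nat (leq_trans (ltnW modlt)).
have divR : (w j)%:R = (w j %/ c.+1)%:R * c.+1%:R + (w j %% c.+1)%:R :> R.
  by rewrite {1}divE natrD natrM.
have uR : (u j.+1)%:R = (w j)%:R + (w j %/ c.+1)%:R :> R by rewrite rE natrD.
have h2 : 2 * C <= e / 2 * (u j.+1)%:R.
  rewrite [leRHS]mulrC -ler_pdivrMr// (le_trans (ltW (archi_boundP _)))//.
    by rewrite divr_ge0 ?mulr_ge0// ltW.
  rewrite ler_nat (leq_trans j2)// (leq_trans (leqnSn _))//.
  exact: cycle_start_ge.
have mC : `|mean nu f - mean mu0 f| <= 2 * C.
  rewrite (le_trans (ler_normB _ _))// mulr_natl lerD//; exact: mean_norm_le.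
have c2 : 0 < c.+2%:R :> R by rewrite ltr0n.
(* The deviation from the exact share comes from integer division and is less than one time unit. *)
have key : ((u j.+1)%:R - (w j)%:R) - (u j.+1)%:R * c.+2%:R^-1 =
    - ((w j %% c.+1)%:R / c.+2%:R) :> R.
  rewrite uR divR -[c.+2%:R]natr1.
  have z0 : c.+1%:R + 1 != 0 :> R by rewrite natr1 lt0r_neq0.
  by move: (c.+1%:R) z0 => z z0; field.
have h3 : `|(((u j.+1)%:R - (w j)%:R) - (u j.+1)%:R * c.+2%:R^-1) *
    (mean nu f - mean mu0 f)| <= 2 * C.
  rewrite normrM key normrN [X in X * _]ger0_norm ?divr_ge0//.
  rewrite -[leRHS]mul1r; by apply: ler_pM; rewrite ?divr_ge0// ler_pdivrMr// mul1r.
move: (birkhoff T f (u j.+1) x) h1 => S h1.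
move: ((u j.+1)%:R) ((w j)%:R) (c.+2%:R^-1) h1 h2 h3 => U W s.
move: (mean nu f) (mean mu0 f) => b d h1 h2 h3.
have -> : S - U * ((1 - s) * d + s * b) =
  (S - W * d - (U - W) * b) + (U - W - U * s) * (b - d) by ring.
by rewrite (le_trans (ler_normD _ _))//; lra.
Qed.

Lemma tends_limit_measures : tends_on J a ->
  (forall j, V (v j)) ->
  (forall F : nat -> X -> R, (forall i, continuous (F i)) ->
    forall mu k N, V mu -> exists2 j, (N <= j)%N & mean_close F k (v j) mu) ->
  limit_measures T x = V.
Proof.
move=> aJ vV v_dense; have [F [cF dF]] := continuous_separable cX.
have ulim N q : (u N <= q)%N -> exists2 j, (N <= j)%N & (u j <= q < u j.+1)%N.
  by apply: increasing_locate_from => j; exact: cycle_start_lt.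
have close_v k : exists N, forall j q, (N <= j)%N -> (u j <= q <= u j.+1)%N ->
    mean_close F k (empirical_measure T x q.-1) (v j).
  have e0 : 0 < k.+2%:R^-1 :> R by rewrite invr_gt0.
  have [N NP] := @eventually_forall_lt (fun i j => forall q, (u j <= q <= u j.+1)%N ->
    `|birkhoff T (F i) q x - q%:R * mean (v j) (F i)| <= k.+2%:R^-1 * q%:R) k
    (fun i => shadowing aJ (@cF i) e0).
  exists N => j q Nj uq; apply: (mean_close_empirical cX cF (e := k.+2%:R^-1)).
  - by case/andP: uq => h _; rewrite (leq_trans _ h)// cycle_start_gt0.
  - by move=> i ik; exact: NP.
  - by rewrite ltf_pV2 ?posrE// ltr_nat.
apply/seteqP; split=> [rho /(limit_measures_close cX cF dF) rhoP|mu Vmu].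
  apply: (closed_mean_close cX cF dF clV) => k.
  have [N NP] := close_v (2 * k + 1)%N.
  have [n Nn nrho] := rhoP (2 * k + 1)%N (u N).
  have [j Nj /andP[ujn nuj]] := ulim N n.+1 (leqW Nn).
  exists (v j) => //; apply: mean_close_trans nrho.
  apply: mean_close_sym; apply: (NP j n.+1 Nj).
  by rewrite ujn ltnW.
apply/(limit_measures_close cX cF dF) => k N.
have [N1 N1P] := close_v (2 * k + 1)%N.
have [j jN jmu] := v_dense F cF mu (2 * k + 1)%N (maxn N1 N.+1) Vmu.
move: jN; rewrite geq_max => /andP[N1j Nj].
exists (u j).-1.
  by rewrite -ltnS prednK ?cycle_start_gt0// (leq_trans Nj)// cycle_start_ge.
apply: mean_close_trans jmu; apply: N1P => //.
by rewrite leqnn ltnW// cycle_start_lt.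
Qed.

(** Some value c recurs infinitely often on J. At the ends of those cycles the averages converge to
    a mixture on the segment from mu0 to nu, which [exitV] keeps out of V. *)
Lemma not_tends_limit_measures mu0 : ~ tends_on J a ->
  (forall j, J j -> v j = mu0) ->
  (forall t rho, 0 < t <= 1 -> (forall f : X -> R, continuous f ->
    mean rho f = (1 - t) * mean mu0 f + t * mean nu f) -> ~ V rho) ->
  ~ limit_measures T x `<=` V.
Proof.
move=> naJ vJ exitV sub; have [F [cF dF]] := continuous_separable cX.
have [c cP] : exists c, forall N, exists j, [/\ (N <= j)%N, J j & a j = c].
  move/existsNP: naJ => [m nm]; apply: (@infinitely_often_value J a m) => N.
  apply: contrapT => nN; apply: nm; exists N => j Nj Jj.
  by rewrite leqNgt; apply/negP => ajm; apply: nN; exists j.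
have t01 : 0 < (c.+2%:R^-1 : R) <= 1.
  by rewrite invr_gt0 ltr0n /= invf_le1// ler1n.
have t01b : 0 <= (c.+2%:R^-1 : R) <= 1 by case/andP: t01 => /ltW -> ->.
have [rho rhoE] := mixture_exists cX mu0 nu t01b.
apply: (@exitV _ rho t01 rhoE); apply: sub.
apply/(limit_measures_close cX cF dF) => k N.
have e0 : 0 < k.+2%:R^-1 :> R by rewrite invr_gt0.
have [N1 N1P] := @eventually_forall_lt _ k (fun i => cycle_perturbed c mu0 (@cF i) e0).
have [j [jN Jj ajc]] := cP (maxn N1 N); move: jN; rewrite geq_max => /andP[N1j Nj].
exists (u j.+1).-1.
  rewrite -ltnS prednK ?cycle_start_gt0//.
  by rewrite (leq_trans _ (cycle_start_ge _ _ _ _)).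
apply: (mean_close_empirical cX cF (e := k.+2%:R^-1)).
- exact: cycle_start_gt0.
- by move=> i ik; rewrite rhoE//; apply: N1P => //; exact: vJ.
- by rewrite ltf_pV2 ?posrE// ltr_nat.
Qed.

End Orbit.

Lemma reduction : invariant_measures T `\` V !=set0 ->
  exists (J : set nat) (f : (nat -> nat) -> X),
  [/\ forall N, exists2 j, (N <= j)%N & J j,
    forall U : set X, open U -> cylinder_open (f @^-1` U),
    forall a, tends_on J a -> limit_measures T (f a) = V
  & forall a, ~ tends_on J a -> ~ limit_measures T (f a) `<=` V].
Proof.
move=> [nu [inu nVnu]]; have [F [cF dF]] := continuous_separable cX.
have [mu0 Vmu0 exitV] := segment_exit cX clV V0 nVnu.
have [v [vV vS v0 vd]] := wandering_sequence cF conV Vmu0.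
pose theta p := if odd p then nu else v p./2.
have itheta p : invariant_measures T (theta p).
  by rewrite /theta; case: ifP => // _; exact: VT.
have [A [y [A0 yP yc]]] := realization cX cT sapT itheta.
pose J := [set j | v j = mu0].
exists J, (fun a => y (schedule J A a)).
have tt a := schedule_timetable J A a.
split.
- exact: v0.
- move=> U oU a /= Ua; have : nbhs (y (schedule J A a)) U by exact: open_nbhs_nbhs.
  move=> /nbhs_mdist[r r0 rU]; have [p pP] := yc _ _ (tt a) r0.
  by exists p => b ab; apply: rU; apply: pP => //; exact: schedule_agree.
- move=> a aJ; apply: (tends_limit_measures A0 (yP _ (tt a)) _ aJ vV).
    move=> f e cf e0; have [K KP] := mean_close_lt cX cF dF cf e0.
    by have [N NP] := vS K; exists N => j /NP; exact: KP.
  move=> G cG mu k N Vmu.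
  (* Density of v is known for the test functions F and is transferred to an arbitrary sequence
     G. *)
  have near i : exists N1, forall N2, (N1 <= N2)%N -> forall rho,
      mean_close F N2 rho mu -> `|mean rho (G i) - mean mu (G i)| < k.+1%:R^-1.
    have k0 : 0 < k.+1%:R^-1 :> R by rewrite invr_gt0.
    have [K KP] := mean_close_lt cX cF dF (cG i) k0.
    by exists K => N2 KN2 rho; exact: KP.
  have [N1 N1P] := eventually_forall_lt k near.
  have [j Nj jmu] := vd mu N1 N Vmu; exists j => // i ik.
  exact: N1P jmu.
- move=> a naJ; apply: (not_tends_limit_measures A0 (yP _ (tt a)) naJ _ exitV).
  by move=> j.
Qed.

End LowerBound.

(** * The Borel classes *)

Section Hierarchy.
Context {X : topologicalType}.

Lemma Pi0_3_intro (A : set X) (H : nat -> nat -> set X) :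
  (forall i k, closed (H i k)) -> A = \bigcap_i \bigcup_k H i k -> Pi0 3 A.
Proof.
move=> cH ->; exists (fun i => ~` (\bigcup_k H i k)); last by rewrite setC_bigcap.
move=> i; exists (H i); last by rewrite setCK.
by move=> k; exact: closed_openC.
Qed.

Lemma Sigma0_3_elim (A : set X) : Sigma0 3 A -> exists O : nat -> nat -> set X,
  (forall i k, open (O i k)) /\ A = \bigcup_i \bigcap_k O i k.
Proof.
move=> [F FS ->].
have /choice[H HP] : forall i, exists H : nat -> set X,
    (forall k, open (~` H k)) /\ ~` F i = \bigcup_k H k.
  by move=> i; have [H oH FH] := FS i; exists H.
exists (fun i k => ~` H i k); split; first by move=> i k; case: (HP i).
by apply: eq_bigcupr => i _; rewrite -setC_bigcup -(HP i).2 setCK.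
Qed.

End Hierarchy.

(** * Upper bounds by a countable family of boxes *)

Section Upper.
Context {R : realType} {X : pmetricType R}.
Hypothesis cX : compact [set: X].
Variable T : X -> X.
Hypothesis cT : continuous T.
Variable F : nat -> X -> R.
Hypothesis cF : forall i, continuous (F i).
Hypothesis dF : forall (f : X -> R) (e : R), continuous f -> 0 < e ->
  exists i, forall x, `|f x - F i x| < e.
Variable V : set (measures X).
Hypothesis clV : closed V.

Let rad (r : nat) : R := r.+1%:R^-1.

Let rad_le r s : (r <= s)%N -> rad s <= rad r.
Proof. by move=> rs; rewrite lef_pV2 ?posrE// ler_nat. Qed.

Let dist (c : seq rat * nat) (i : nat) (mu : measures X) : R :=
  `|mean mu (F i) - ratr (nth 0 c.1 i)|.

(** A box is coded by rational centres for the first means and a radius index. Visits to open boxes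
    are open conditions on x, visits to closed boxes closed ones; half boxes keep a measure well
    inside. *)
Let open_box c mu := forall i, (i < size c.1)%N -> dist c i mu < rad c.2.
Let closed_box c mu := forall i, (i < size c.1)%N -> dist c i mu <= rad c.2.
Let half_box c mu := forall i, (i < size c.1)%N -> dist c i mu < rad (2 * c.2 + 1).

Lemma rational_center mu k r : exists2 c, size c.1 = k & half_box c mu /\ c.2 = r.
Proof.
have /choice[q qP] : forall i, exists q : rat, `|mean mu (F i) - ratr q| < rad (2 * r + 1).
  move=> i; have r0 : 0 < rad (2 * r + 1) by rewrite invr_gt0.
  move: (rad _) r0 => d d0; move: (mean mu (F i)) => x.
  have lt_q : x - d < x + d by lra.
  have [q] := rat_in_itvoo lt_q; rewrite in_itv /= => /andP[h1 h2].
  by exists q; rewrite distrC ltr_norml; apply/andP; split; lra.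
exists (mkseq q k, r); rewrite ?size_mkseq//; split=> // i /=.
by rewrite size_mkseq => ik; rewrite /dist nth_mkseq.
Qed.

Lemma half_box_center c mu nu : half_box c mu -> closed_box c nu ->
  forall k, c.2 = (2 * k + 1)%N -> size c.1 = k -> mean_close F k nu mu.
Proof.
move=> hmu cnu k ck sk i ik; rewrite half_radius -ck.
rewrite (le_lt_trans (ler_distD (ratr (nth 0 c.1 i)) _ _))// ler_ltD//.
  by apply: cnu; rewrite sk.
rewrite distrC (lt_le_trans (hmu i _)) ?sk//; apply: rad_le; lia.
Qed.

Lemma half_box_close c mu nu : half_box c mu ->
  mean_close F (maxn (size c.1) (2 * c.2 + 1)) nu mu -> open_box c nu.
Proof.
move=> hmu cnu i ic; rewrite /dist /rad half_radius.
rewrite (le_lt_trans (ler_distD (mean mu (F i)) _ _))// ltrD//; last exact: hmu.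
rewrite (lt_le_trans (cnu i _))//; first by rewrite (leq_trans ic)// leq_maxl.
by apply: rad_le; exact: leq_maxr.
Qed.

Let box_at (m : nat) : seq rat * nat := odflt ([::], 0%N) (choice.unpickle m).

Let box_atK c : box_at (choice.pickle c) = c.
Proof. by rewrite /box_at choice.pickleK. Qed.

Let emp x n := empirical_measure T x n.

Lemma continuous_emp_dist c i n : continuous (fun x => dist c i (emp x n)).
Proof.
have -> : (fun x => dist c i (emp x n)) =
    (fun x => `|birkhoff T (F i) n.+1 x * n.+1%:R^-1 - ratr (nth 0 c.1 i)|).
  by apply/funext => x; rewrite /dist mean_empirical.
move=> x; apply: cvg_norm; apply: cvgB; last exact: cvg_cst.
by apply: cvgM; [exact: continuous_birkhoff|exact: cvg_cst].
Qed.

Lemma closed_emp_closed_box c n : closed [set x | closed_box c (emp x n)].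
Proof.
have -> : [set x | closed_box c (emp x n)] = \bigcap_(i in `I_(size c.1))
    ((fun x => dist c i (emp x n)) @^-1` [set y | y <= rad c.2]).
  by apply/seteqP; split=> x H i; exact: H.
apply: closed_bigI => i _; apply: closed_comp; last exact: closed_le.
by move=> x _; exact: continuous_emp_dist.
Qed.

Lemma open_emp_open_box c n : open [set x | open_box c (emp x n)].
Proof.
have -> : [set x | open_box c (emp x n)] = \bigcap_(i in `I_(size c.1))
    ((fun x => dist c i (emp x n)) @^-1` [set y | y < rad c.2]).
  by apply/seteqP; split=> x H i; exact: H.
rewrite bigcap_mkord; elim/big_ind: _ => [|A B oA oB|i _].
- exact: openT.
- exact: openI.
- have /continuousP := @continuous_emp_dist c i n.
  by apply; exact: open_lt.
Qed.

(** The premise does not involve x; as an implication it lets m range over all naturals, irrelevant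
    boxes giving the whole space. *)
Let avoid m N : set X := [set x | closed_box (box_at m) `&` V = set0 ->
  forall n, (N <= n)%N -> ~ open_box (box_at m) (emp x n)].

Let visit m N k : set X := [set x | (exists2 v, V v & half_box (box_at m) v) ->
  (N <= k)%N /\ closed_box (box_at m) (emp x k)].

Lemma closed_avoid m N : closed (avoid m N).
Proof.
have [e|ne] := pselect (closed_box (box_at m) `&` V = set0); last first.
  by rewrite (_ : avoid m N = setT); [exact: closedT|apply/seteqP; split=> // x _ /ne].
have -> : avoid m N = \bigcap_(n in [set n | (N <= n)%N])
    ~` [set x | open_box (box_at m) (emp x n)].
  by apply/seteqP; split=> [x /(_ e) H n|x H _ n]; exact: H.
by apply: closed_bigI => n _; apply: open_closedC; exact: open_emp_open_box.
Qed.

Lemma closed_visit m N k : closed (visit m N k).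
Proof.
have [e|ne] := pselect (exists2 v, V v & half_box (box_at m) v); last first.
  by rewrite (_ : visit m N k = setT); [exact: closedT|apply/seteqP; split=> // x _ /ne].
have [Nk|kN] := leqP N k; last first.
  rewrite (_ : visit m N k = set0); first exact: closed0.
  by apply/seteqP; split=> // x /(_ e)[]; rewrite leqNgt kN.
rewrite (_ : visit m N k = [set x | closed_box (box_at m) (emp x k)]).
  exact: closed_emp_closed_box.
by apply/seteqP; split=> [x /(_ e)[]|x].
Qed.

(** Infinitely many visits to an open box whose closed box misses V would yield a limit measure in
    that closed box. Conversely a limit measure outside V lies in such a box, which is visited
    infinitely often. *)
Lemma G_sub_avoid : G_sub T V = \bigcap_m \bigcup_N avoid m N.
Proof.
apply/seteqP; split=> [x xV m _|x xH mu mux].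
  have [e|ne] := pselect (closed_box (box_at m) `&` V = set0); last first.
    by exists 0%N => // /ne.
  apply: contrapT => nN.
  have [|mu mux muP] := @limit_measures_exist _ _ cX F cF dF T x
      [set n | open_box (box_at m) (emp x n)].
    move=> N; apply: contrapT => nn; apply: nN; exists N => // _ n Nn on.
    by apply: nn; exists n.
  have : (closed_box (box_at m) `&` V) mu; last by rewrite e.
  split; last exact: xV.
  move=> i im; set q := ratr (nth 0 (box_at m).1 i) : R.
  have h1 : mean mu (F i) <= q + rad (box_at m).2.
    apply: muP => // n /(_ i im); rewrite /dist ltr_norml => /andP[_].
    by rewrite -/q -/(emp x n); lra.
  (* [limit_measures_exist] preserves upper bounds only; the lower bound is the upper bound for the
     negated function. *)
  have cN : continuous (fun x => - 1 * F i x).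
    by move=> y; apply: cvgM; [exact: cvg_cst|exact: cF].
  have : mean mu (fun x => - 1 * F i x) <= - q + rad (box_at m).2.
    apply: muP => // n /(_ i im); rewrite /dist ltr_norml meanZ// => /andP[+ _].
    by rewrite -/q -/(emp x n); lra.
  by rewrite meanZ// /dist -/q ler_norml => h2; apply/andP; split; lra.
apply: contrapT => nVmu; apply: nVmu; apply: (closed_mean_close cX cF dF clV) => k.
have [c sc [cmu ck]] := rational_center mu k (2 * k + 1).
apply: contrapT => nk.
have [N _ /=] := xH (choice.pickle c) I; rewrite /avoid /= box_atK => H.
have [n Nn nmu] := (limit_measures_close cX cF dF T x mu).1 mux
  (maxn (size c.1) (2 * c.2 + 1)) N.
apply: (H _ n Nn); last exact: half_box_close cmu nmu.
rewrite -subset0 => nu [cnu Vnu]; apply: nk; exists nu => //.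
exact: half_box_center cmu cnu _ ck sc.
Qed.

(** The conditions for all points of V reduce to one for each box, since a point of V is approached
    by the boxes whose half contains it. *)
Lemma sub_limit_measures x : V `<=` limit_measures T x <->
  forall m N, exists k, visit m N k x.
Proof.
split=> [Vx m N|H v Vv].
  have [[v Vv hv]|nv] := pselect (exists2 v, V v & half_box (box_at m) v); last first.
    by exists 0%N => /nv.
  have [n Nn nv] := (limit_measures_close cX cF dF T x v).1 (Vx v Vv)
    (maxn (size (box_at m).1) (2 * (box_at m).2 + 1)) N.
  exists n => _; split=> // i im; apply/ltW.
  exact: half_box_close hv nv i im.
apply/(limit_measures_close cX cF dF) => k N.
have [c sc [cv ck]] := rational_center v k (2 * k + 1).
have [n] := H (choice.pickle c) N; rewrite /visit /= box_atK => -[|Nn cn].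
  by exists v.
by exists n => //; exact: half_box_center cv cn _ ck sc.
Qed.

Lemma Pi0_3_G_sub : Pi0 3 (G_sub T V).
Proof. exact: Pi0_3_intro closed_avoid G_sub_avoid. Qed.

Lemma Pi0_3_G_eq : Pi0 3 (G_eq T V).
Proof.
pose mN i : nat * nat := odflt (0, 0)%N (choice.unpickle i).
(* Even indices express that V(x) lies in V, odd ones the reverse inclusion. *)
pose H i k := if odd i then visit (mN i./2).1 (mN i./2).2 k else avoid i./2 k.
apply: (@Pi0_3_intro _ _ H).
  by move=> i k; rewrite /H; case: ifP => _; [exact: closed_visit|exact: closed_avoid].
apply/seteqP; split=> [x xV i _|x xH].
  have [oi|ei] := boolP (odd i).
    have Vx : V `<=` limit_measures T x by rewrite xV.
    have [k kP] := (sub_limit_measures x).1 Vx (mN i./2).1 (mN i./2).2.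
    by exists k => //; rewrite /H oi.
  have : G_sub T V x by move=> mu; rewrite -xV.
  rewrite G_sub_avoid => /(_ i./2 I)[N _ xN].
  by exists N => //; rewrite /H (negbTE ei).
apply/seteqP; split.
  suff : G_sub T V x by [].
  rewrite G_sub_avoid => m _; have := xH (2 * m)%N I.
  by rewrite /H mul2n odd_double doubleK.
apply/sub_limit_measures => m N.
have := xH (2 * choice.pickle (m, N)).+1 I.
rewrite /H mul2n /= odd_double /= uphalf_double /mN choice.pickleK /=.
by move=> [k _ kP]; exists k.
Qed.

End Upper.

Theorem corollary30 (R : realType) (X : pmetricType R) (T : X -> X)
    (V : set (measures X)) :
  compact [set: X] ->
  continuous T ->
  strong_approx_product_structure T ->
  V `<=` invariant_measures T ->
  V !=set0 ->
  closed V ->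
  connected V ->
  invariant_measures T `\` V !=set0 ->
  (Pi0_complete 3 (G_sub T V) /\ Pi0_complete 3 (G_eq T V)) /\
  Sigma0_complete 3 (G_meet T (invariant_measures T `\` V)).
Proof.
move=> cX cT sapT VT V0 clV conV UT0.
have [F [cF dF]] := continuous_separable cX.
have [J [f [Jinf cf fV fnV]]] := reduction cX cT sapT VT V0 clV conV UT0.
(* A Sigma^0_3 set S would pull back along f to such a description of the sequences tending to
   infinity on J. *)
have hard (S : set X) : (forall a, tends_on J a -> S (f a)) ->
    (forall a, ~ tends_on J a -> ~ S (f a)) -> ~ Sigma0 3 S.
  move=> fS fnS /Sigma0_3_elim[W [oW SE]].
  apply: (@tends_on_not_Sigma3 J (fun i k => f @^-1` W i k) Jinf).
    by move=> i k; apply: cf; exact: oW.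
  move=> a; have SO : S (f a) <-> exists i, forall k, (f @^-1` W i k) a.
    rewrite SE; split=> [[i _ H]|[i H]]; exists i => // k; first exact: H.
    by move=> _; exact: H.
  split=> [h|/SO Sfa]; first exact/SO/fS.
  by apply: contrapT => /fnS.
have nG : ~ Sigma0 3 (G_sub T V).
  by apply: hard => a h; [move=> mu; rewrite fV|exact: fnV].
have PG := Pi0_3_G_sub cX cT cF dF clV.
(* A limit measure outside V lies in the complement of V within the invariant measures, being itself
   invariant. *)
have GmE : G_meet T (invariant_measures T `\` V) = ~` G_sub T V.
  apply/seteqP; split=> [x [mu [mux [_ nVmu]]] /(_ mu mux) // | x nxV].
  apply: contrapT => nm; apply: nxV => mu mux; apply: contrapT => nVmu; apply: nm.
  by exists mu; split=> //; split=> //; exact: (limit_measures_invariant cX cT mux).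
split; last by rewrite GmE; split=> //; rewrite /Pi0 /= setCK.
split; split=> //; first exact: (Pi0_3_G_eq cX cT cF dF clV).
apply: hard => a h; first exact: fV.
by move=> e; apply: (fnV a h); rewrite e.
Qed.
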